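(* Let $G$ be a directed graph with connected components $\{G_{\lambda_1}\}_{\lambda_1\in\Lambda_1}\cup\{G_{\lambda_2}\}_{\lambda_2\in\Lambda_2}$ such that each $G_{\lambda_1}$ is strongly connected and each $G_{\lambda_2}$ is not strongly connected. If every bounded derivation on $\mathcal{A}_G$ is of the form $\delta_T$ for some $T\in\mathfrak{L}_G$, then each $G_{\lambda_2}$ is a generalized fruit tree and $\sup_{\lambda_2\in\Lambda_2}A(G_{\lambda_2})<\infty$, where $A(\cdot)$ denotes the alternating number.
   Context: A directed graph $G=(\mathcal{V},\mathcal{E},s,r)$ has a vertex set $\mathcal{V}$ and an edge set $\mathcal{E}$ (each of arbitrary cardinality; loops and multiple edges allowed) and source and range maps $s,r\colon\mathcal{E}\to\mathcal{V}$; an edge $e$ is an arrow from $s(e)$ to $r(e)$. $\mathbb{F}_G^+$ is the set of all directed paths of finite length: vertices $v$ are paths of length $0$ with $r(v)=s(v)=v$, and a path of length $n\geq1$ is $p=e_1e_2\cdots e_n$ with $s(e_j)=r(e_{j+1})$, $r(p)=r(e_1)$, $s(p)=s(e_n)$; if $s(p_1)=r(p_2)$, the product $p_1p_2$ is the concatenation. Let $\mathcal{H}_G=\ell^2(\mathbb{F}_G^+)$ with orthonormal basis $\{\xi_w\}$. For $e\in\mathcal{E}$, $L_e\xi_w=\xi_{ew}$ if $r(w)=s(e)$ and $0$ otherwise; for $x\in\mathcal{V}$, $L_x\xi_w=\xi_w$ if $r(w)=x$ and $0$ otherwise. $\mathfrak{L}_G$ is the weak-operator closed algebra, and $\mathcal{A}_G$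 the norm-closed algebra, generated by $\{L_e,L_x\}$ in $B(\mathcal{H}_G)$. A derivation on $\mathcal{A}_G$ is a linear map $\delta\colon\mathcal{A}_G\to\mathcal{A}_G$ with $\delta(AB)=\delta(A)B+A\delta(B)$; for $T\in\mathfrak{L}_G$, $\delta_T(A)=AT-TA$. $G$ is strongly connected if for any vertices $x,y$ there is a directed path from $x$ to $y$ (a single vertex with no edge is strongly connected). Connectedness and connected components refer to the underlying undirected graph. The $n$-circle graph $\mathscr{C}_n$ ($n\geq1$) has distinct vertices $v_1,\dots,v_n$ and edges $e_1,\dots,e_n$ with $r(e_j)=v_j$, $s(e_j)=v_{j+1\,(\mathrm{mod}\,n)}$. A polygon of length $n\geq1$ is a set of distinct vertices $v_1,\dots,v_n$ and distinct edges $e_1,\dots,e_n$ with $\{r(e_j),s(e_j)\}=\{v_j,v_{j+1\,(\mathrm{mod}\,n)}\}$. A generalized tree is a connected directed graph with at least two vertices containing no polygon; a leaf is a vertex of it of degree one (total number of incident edges). Let $G_t$ be a generalized tree with vertex set $\mathcal{V}_t$, $V=\{v_\lambda\}$ a (possibly empty) subset of its leaves with $V\neq\mathcal{V}_t$, and $G_f$ a directed graph whose connected components are circle graphs $\mathscr{C}_{n_\lambda}$, one for each $v_\lambda$. The graph $G_t\sqcup_V G_f$ obtained by identifying each $v_\lambda$ with a vertex of $\mathscr{C}_{n_\lambda}$ (no other identifications; the edge set is the disjoint union) is called a generalized fruit tree. A line $L$ of length $n\geq1$ in $G$ consists of distinct vertices $v_1,\dots,v_{n+1}$ and edges $e_1,\dots,e_n$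 with $\{r(e_j),s(e_j)\}=\{v_j,v_{j+1}\}$. A vertex $v$ of $L$ is alternating if, among the edges of $L$, exactly two have source $v$ or exactly two have range $v$. $A(L)$ is the number of alternating vertices of $L$, and the alternating number is $A(G)=\sup\{A(L)\colon L\text{ a line in }G\}$. *)

(* Defs.v *)
From HB Require Import structures.
From Stdlib Require Import Relations.
From mathcomp Require Import all_boot all_order all_algebra.
From mathcomp Require Import complex ring lra.
From mathcomp Require Import all_classical all_reals.
From mathcomp Require Import ereal esum numfun.

Set Implicit Arguments.
Unset Strict Implicit.
Unset Printing Implicit Defensive.

Import Order.TTheory GRing.Theory Num.Theory.

Local Open Scope classical_set_scope.
Local Open Scope ring_scope.

Section SquareSummable.
Context {R : realType} {W : choiceType}.
Implicit Types f g : W -> R[i].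

Definition sqsum f : \bar R :=
  \esum_(w in [set: W]) (Normc.normc (f w) ^+ 2)%:E.

Definition square_summable : {pred W -> R[i]} := [pred f | (sqsum f < +oo)%E].

Lemma normc_ge0 (z : R[i]) : 0 <= Normc.normc z.
Proof. by case: z => a b; rewrite sqrtr_ge0. Qed.

Lemma sqnormc_ge0 (z : R[i]) : (0 <= (Normc.normc z ^+ 2)%:E)%E.
Proof. by rewrite lee_fin exprn_ge0// normc_ge0. Qed.

Lemma sqsum_ge0 f : (0 <= sqsum f)%E.
Proof. by apply: esum_ge0 => w _; exact: sqnormc_ge0. Qed.

Lemma sqsumZ_le (k : R[i]) f :
  (sqsum (k *: f)%R <= (Normc.normc k ^+ 2)%:E * sqsum f)%E.
Proof.
apply: ge_ereal_sup => _ [A [finA _] <-].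
rewrite (eq_fsbigr (fun w => (Normc.normc k ^+ 2)%:E *
    (Normc.normc (f w) ^+ 2)%:E)%E); last first.
  by move=> w _; rewrite -EFinM -exprMn -Normc.normcM.
rewrite -ge0_mule_fsumr; last by move=> w; exact: sqnormc_ge0.
apply: lee_wpmul2l; first exact: sqnormc_ge0.
by apply: esum_ge; exists A => //.
Qed.

Lemma sqsumD_le f g :
  (sqsum (f + g)%R <= sqsum f + sqsum f + (sqsum g + sqsum g))%E.
Proof.
have sq0 h w : [set: W] w -> (0 <= (Normc.normc (h w : R[i]) ^+ 2)%:E)%E.
  by move=> _; exact: sqnormc_ge0.
have sq20 h w : [set: W] w -> (0 <= (Normc.normc (h w : R[i]) ^+ 2)%:E +
   (Normc.normc (h w : R[i]) ^+ 2)%:E)%E.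
  by move=> _; rewrite adde_ge0 ?sq0.
rewrite /sqsum -(esumD (sq0 f) (sq0 f)) -(esumD (sq0 g) (sq0 g)).
rewrite -(esumD (sq20 f) (sq20 g)).
apply: le_esum => w _; rewrite -!EFinD lee_fin.
have := le_normcD (f w) (g w).
have := normc_ge0 ((f + g) w); rewrite [(f + g) w]/(f w + g w).
set a := Normc.normc (f w); set b := Normc.normc (g w); set c := Normc.normc _.
by move=> c0 cab; have := sqr_ge0 (a - b); nra.
Qed.

Fact square_summable_submod_closed : submod_closed square_summable.
Proof.
split=> [|k f g]; rewrite !inE.
  rewrite /sqsum esum1 ?ltry// => w _ /=.
  by rewrite /= expr0n addr0 sqrtr0 expr0n.
move=> foo goo; apply: le_lt_trans (sqsumD_le _ _) _.
have kfoo : (sqsum (k *: f)%R < +oo)%E.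
  apply: le_lt_trans (sqsumZ_le _ _) _.
  have : sqsum f \is a fin_num by rewrite ge0_fin_numE ?sqsum_ge0.
  by move=> /fineK <-; rewrite -EFinM ltry.
by rewrite !lte_add_pinfty.
Qed.
HB.instance Definition _ :=
  GRing.isSubmodClosed.Build R[i] (W -> R[i]) square_summable
    square_summable_submod_closed.

End SquareSummable.

Record ell2 (R : realType) (W : choiceType) := Ell2 {
  ell2_val :> W -> R[i];
  ell2_valP : ell2_val \in square_summable }.

Section Ell2.
Context {R : realType} {W : choiceType}.
Local Notation H := (ell2 R W).

HB.instance Definition _ := [isSub for @ell2_val R W].
HB.instance Definition _ := [Choice of H by <:].
HB.instance Definition _ := [SubChoice_isSubLmodule of H by <:].

(* Sum of an absolutely summable family of reals, indexed by an arbitrary set. *)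
Definition rsum (a : W -> R) : R :=
  let b := EFin \o a in
  fine (\esum_(w in [set: W]) (b^\+)%E w - \esum_(w in [set: W]) (b^\-)%E w)%E.

Definition csum (z : W -> R[i]) : R[i] :=
  (rsum (fun w => complex.Re (z w)) +i* rsum (fun w => complex.Im (z w)))%C.

Definition dotp (f g : H) : R[i] := csum (fun w => f w * (g w)^*%C).

Definition norm2 (f : H) : R := Num.sqrt (fine (sqsum f)).

Fact delta_square_summable (w : W) :
  (fun v => if v == w then 1 else 0 : R[i]) \in square_summable.
Proof.
rewrite inE /sqsum.
rewrite (_ : esum _ _ = \esum_(v in [set w]) (1 : R)%:E).
  by rewrite esum_set1 ?ltry ?lee_fin.
rewrite [RHS]esum_mkcond; apply: eq_esum => v _.
rewrite (_ : (v \in [set w]) = (v == w)); last by apply/idP/eqP; rewrite inE.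
case: ifP => _.
  by rewrite Normc.normc1 expr1n.
by rewrite Normc.normc0 expr0n.
Qed.

Definition xi (w : W) : H := Ell2 (delta_square_summable w).

Definition bounded_op (T : H -> H) : Prop :=
  linear T /\ exists M : R, forall f, norm2 (T f) <= M * norm2 f.

Definition opnorm (T : H -> H) : R :=
  sup [set norm2 (T f) | f in [set f : H | norm2 f <= 1]].

Definition subalgebra (A : set (H -> H)) : Prop :=
  [/\ A `<=` bounded_op, A 0,
      forall (c : R[i]) S T, A S -> A T -> A (c *: S + T)
    & forall S T, A S -> A T -> A (S \o T)].

Definition norm_closed (A : set (H -> H)) : Prop :=
  forall T, bounded_op T ->
    (forall e : R, 0 < e -> exists2 S, A S & opnorm (T - S) < e) -> A T.

Definition wot_closed (A : set (H -> H)) : Prop :=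
  forall T, bounded_op T ->
    (forall (s : seq (H * H)) (e : R), 0 < e ->
       exists2 S, A S &
         forall p, p \in s -> Normc.normc (dotp (T p.1 - S p.1) p.2) < e) ->
  A T.

Definition norm_closed_algebra (X : set (H -> H)) : set (H -> H) :=
  smallest (fun A => subalgebra A /\ norm_closed A) X.

Definition wot_closed_algebra (X : set (H -> H)) : set (H -> H) :=
  smallest (fun A => subalgebra A /\ wot_closed A) X.

(* A derivation of A is represented by a map on all functions H -> H; only its
   values on A are constrained. *)
Definition bounded_derivation (A : set (H -> H)) (d : (H -> H) -> (H -> H)) :=
  [/\ forall T, A T -> A (d T),
      forall (c : R[i]) S T, A S -> A T -> d (c *: S + T) = c *: d S + d T,
      forall S T, A S -> A T -> d (S \o T) = (d S \o T) + (S \o d T)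
    & exists M : R, forall T, A T -> opnorm (d T) <= M * opnorm T].

Definition inner_derivation (T A : H -> H) : H -> H := (A \o T) - (T \o A).

End Ell2.

(* [rng] is the range map: an edge goes from [src] to [rng]. *)
Record digraph := Digraph {
  vertex : choiceType;
  edge : choiceType;
  src : edge -> vertex;
  rng : edge -> vertex }.
Arguments src {d}.
Arguments rng {d}.

Section Paths.
Variable G : digraph.
Implicit Types (x y : vertex G) (e : edge G) (es : seq (edge G)).

Fixpoint chain x es : bool :=
  if es is e :: es' then (rng e == x) && chain (src e) es' else true.

(* The path e_1 ... e_n with range x is stored as (x, [:: e_1; ...; e_n]), and
   the vertex x, as a path of length 0, is (x, [::]). *)
Record dipath := Dipath {
  dipath_val :> vertex G * seq (edge G);
  dipath_valP : chain dipath_val.1 dipath_val.2 }.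

HB.instance Definition _ := [isSub for dipath_val].
HB.instance Definition _ := [Choice of dipath by <:].

Definition prng (p : dipath) : vertex G := p.1.
Definition psrc (p : dipath) : vertex G := last p.1 (map src p.2).

(* [Some] of the product e p if s(e) = r(p), and [None] otherwise. *)
Definition econs e (p : dipath) : option dipath :=
  if prng p == src e then insub (rng e, e :: p.2) else None.

Lemma econsP e p q : reflect (econs e p = Some q)
  [&& prng p == src e, prng q == rng e & q.2 == e :: p.2].
Proof.
case: p => -[x es] /= xes; case: q => -[y fs] /= yfs; rewrite /econs /prng /=.
case: eqP => [xe|] /=; last by constructor.
apply: (iffP andP) => [[/eqP ye /eqP fse]|].
  by subst; rewrite insubT /= ?eqxx// => H; congr Some; apply/val_inj.
by case: insubP => //= q _ vq [qE]; move: vq; rewrite qE /= => -[-> ->].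
Qed.

(* [Some p] if q is the product e p, and [None] otherwise. *)
Definition ecut e (q : dipath) : option dipath :=
  if q.2 is e' :: es then if e' == e then insub (src e, es) else None else None.

Lemma ecutP e p q : ecut e q = Some p <-> econs e p = Some q.
Proof.
split=> [|/econsP /and3P[/eqP pe /eqP qe /eqP qE]]; last first.
  rewrite /ecut qE eqxx; case: p pe qE => -[x es] /= xes; rewrite /prng /= => xe _.
  by subst; rewrite insubT; congr Some; apply/val_inj.
rewrite /ecut; case: q => -[y [|e' es]] //= yes.
have /andP[/= /eqP e'y _] := yes.
case: eqP => // e'e; case: insubP => //= p' _ vp' [<-].
by apply/econsP; rewrite /prng vp' /= -e'e e'y !eqxx.
Qed.

Definition strongly_connected : Prop :=
  forall x y, exists p : dipath, psrc p = x /\ prng p = y.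

Definition adjacent x y : Prop := exists e, src e = x /\ rng e = y.

Definition uconnect : vertex G -> vertex G -> Prop :=
  clos_refl_sym_trans _ adjacent.

Definition connected : Prop := forall x y, uconnect x y.

Definition component_of x : set (vertex G) := [set y | uconnect x y].

Definition components : set (set (vertex G)) := range component_of.

Definition polygon n (v : 'I_n -> vertex G) (e : 'I_n -> edge G) : Prop :=
  [/\ injective v, injective e
    & forall j, [set rng (e j); src (e j)] = [set v j; v (ordS j)]].

Definition generalized_tree : Prop :=
  [/\ connected, exists x y, x <> y
    & forall n (v : 'I_n -> vertex G) (e : 'I_n -> edge G),
        (0 < n)%N -> ~ polygon v e].

(* The degree of x is the cardinality of this set as long as there is no loop
   at x; leaves are only considered in generalized trees, which have none. *)
Definition incident_edges x : set (edge G) := [set e | src e = x \/ rng e = x].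

Definition leaf : set (vertex G) :=
  [set x | exists e, incident_edges x = [set e]].

Definition line n (v : 'I_n.+1 -> vertex G) (e : 'I_n -> edge G) : Prop :=
  injective v /\ forall j : 'I_n,
    [set rng (e j); src (e j)] = [set v (widen_ord (leqnSn n) j); v (lift ord0 j)].

Definition alternating n (v : 'I_n.+1 -> vertex G) (e : 'I_n -> edge G)
    (i : 'I_n.+1) : bool :=
  (#|[pred j | src (e j) == v i]| == 2) || (#|[pred j | rng (e j) == v i]| == 2).

Definition nb_alternating n (v : 'I_n.+1 -> vertex G) (e : 'I_n -> edge G) : nat :=
  #|[pred i | alternating v e i]|.

(* The supremum of the empty set is -oo: this is the value for a graph without
   lines. *)
Definition alternating_number (R : realType) : \bar R :=
  ereal_sup [set a : \bar R |
    exists n (v : 'I_n.+1 -> vertex G) (e : 'I_n -> edge G),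
    [/\ (0 < n)%N, line v e & a = (nb_alternating v e)%:R%:E]].

End Paths.

Arguments strongly_connected : clear implicits.
Arguments components : clear implicits.
Arguments leaf : clear implicits.

Section Induced.
Variables (G : digraph) (C : set (vertex G)).

Definition induced : digraph :=
  @Digraph {x : vertex G | x \in C}
    {e : edge G | (src e \in C) && (rng e \in C)}
    (fun e => exist _ (src (val e)) (proj1 (andP (valP e))))
    (fun e => exist _ (rng (val e)) (proj2 (andP (valP e)))).

End Induced.

Definition isomorphic (G G' : digraph) : Prop :=
  exists (fv : vertex G -> vertex G') (fe : edge G -> edge G'),
    [/\ bijective fv, bijective fe,
        forall e, src (fe e) = fv (src e)
      & forall e, rng (fe e) = fv (rng e)].

Definition circle (n : nat) : digraph :=
  @Digraph 'I_n 'I_n (@ordS n) id.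

Definition disjoint_union (I : choiceType) (F : I -> digraph) : digraph :=
  @Digraph {i : I & vertex (F i)} {i : I & edge (F i)}
    (fun e => Tagged (fun i => vertex (F i)) (src (tagged e)))
    (fun e => Tagged (fun i => vertex (F i)) (rng (tagged e))).

(* The fruit at l is a circle of length n l >= 1, since u l is one of its
   vertices. *)
Section FruitTree.
Variables (Gt : digraph) (V : set (vertex Gt)) (n : V -> nat).
Variable u : forall l : V, vertex (circle (n l)).

Definition fruits : digraph := disjoint_union (fun l : V => circle (n l)).

Definition attach (x : vertex Gt + vertex fruits) : vertex Gt + vertex fruits :=
  if x is inr y then
    if tagged y == u (tag y) then inl (val (tag y)) else x
  else x.

(* The equivalence relation generated by [inl l ~ inr (l, u l)], for l in V. *)
Definition glued : rel (vertex Gt + vertex fruits) :=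
  fun x y => attach x == attach y.

Fact glued_refl : reflexive glued. Proof. by move=> x; exact: eqxx. Qed.
Fact glued_sym : symmetric glued. Proof. by move=> x y; exact: eq_sym. Qed.
Fact glued_trans : transitive glued.
Proof. by move=> y x z /eqP xy /eqP yz; apply/eqP; rewrite xy. Qed.

Canonical glued_equiv := EquivRel glued glued_refl glued_sym glued_trans.

Definition union_src (e : edge Gt + edge fruits) : vertex Gt + vertex fruits :=
  match e with inl e => inl (src e) | inr e => inr (src e) end.

Definition union_rng (e : edge Gt + edge fruits) : vertex Gt + vertex fruits :=
  match e with inl e => inl (rng e) | inr e => inr (rng e) end.

Definition grafted : digraph :=
  @Digraph {eq_quot glued}%qT (edge Gt + edge fruits)%type
    (fun e => \pi_({eq_quot glued})%qT (union_src e))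
    (fun e => \pi_({eq_quot glued})%qT (union_rng e)).

End FruitTree.

Definition generalized_fruit_tree (G : digraph) : Prop :=
  exists (Gt : digraph) (V : set (vertex Gt)) (n : V -> nat)
         (u : forall l : V, vertex (circle (n l))),
    [/\ generalized_tree Gt, V `<=` leaf Gt, V <> setT
      & isomorphic G (grafted u)].

Section PartialReindexing.
Context {R : realType} {W : choiceType}.
Variable c : W -> option W.
Hypothesis c_inj : forall u v w, c u = Some w -> c v = Some w -> u = v.

Lemma sqsum_reindex_le (f : W -> R[i]) :
  (sqsum (fun u => oapp f 0%R (c u)) <= sqsum f)%E.
Proof.
pose D := [set u | c u].
pose h u := odflt u (c u).
rewrite /sqsum.
rewrite (_ : esum _ _ = \esum_(u in D) (Normc.normc (f (h u)) ^+ 2)%:E); last first.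
  rewrite [RHS]esum_mkcond; apply: eq_esum => u _; rewrite /h.
  case: ifPn => [|/negP]; rewrite inE /D /=; case: (c u) => // _.
  by rewrite [oapp _ _ _]/= Normc.normc0 expr0n.
rewrite -(@reindex_esum R W W D (h @` D) h (fun w => (Normc.normc (f w) ^+ 2)%:E)).
  by apply: ge_ereal_sup => _ [A [finA _] <-]; apply: esum_ge; exists A.
split=> [u Du|u v|] //.
rewrite !inE /D /h /=; case cu : (c u) => [w|]//; case cv : (c v) => [w'|]//= _ _.
by move=> ww'; apply: c_inj cu _; rewrite ww'.
Qed.

Fact reindex_square_summable (f : ell2 R W) :
  (fun u => oapp f 0 (c u)) \in square_summable.
Proof.
by rewrite inE; apply: le_lt_trans (sqsum_reindex_le _) _; have := ell2_valP f; rewrite inE.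
Qed.

Definition reindex_op (f : ell2 R W) : ell2 R W :=
  Ell2 (reindex_square_summable f).

Lemma bounded_reindex_op : bounded_op reindex_op.
Proof.
split=> [k f g|].
  apply/val_inj/funext => u /=.
  transitivity (k * oapp f 0 (c u) + oapp g 0 (c u)); last by [].
  by case: (c u) => [w|] //=; rewrite mulr0 addr0.
exists 1 => f; rewrite mul1r ler_wsqrtr// fine_le//.
- by rewrite ge0_fin_numE ?sqsum_ge0//; have := reindex_square_summable f; rewrite inE.
- by rewrite ge0_fin_numE ?sqsum_ge0//; have := ell2_valP f; rewrite inE.
- exact: sqsum_reindex_le.
Qed.

End PartialReindexing.

Section GraphAlgebras.
Variables (R : realType) (G : digraph).
Local Notation H := (ell2 R (dipath G)).

Fact ecut_inj (e : edge G) u v w :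
  ecut e u = Some w -> ecut e v = Some w -> u = v.
Proof. by rewrite !ecutP => -> []. Qed.

Definition vcut (x : vertex G) (q : dipath G) : option (dipath G) :=
  if prng q == x then Some q else None.

Fact vcut_inj (x : vertex G) u v w :
  vcut x u = Some w -> vcut x v = Some w -> u = v.
Proof. by rewrite /vcut; case: ifP => // _ [->]; case: ifP => // _ [->]. Qed.

(* Given by their coefficients; Ledge_xi and Lvertex_xi below give the usual
   description on the orthonormal basis. *)
Definition Ledge (e : edge G) : H -> H := reindex_op (@ecut_inj e).
Definition Lvertex (x : vertex G) : H -> H := reindex_op (@vcut_inj x).

Lemma Ledge_xi e w : Ledge e (xi w) = oapp xi 0 (econs e w).
Proof.
apply/val_inj/funext => u /=.
case eu : (ecut e u) => [w'|] /=.
  have /= := eu; rewrite ecutP => ew'; case: eqP => [<-|w'w].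
    by rewrite ew' /= eqxx.
  case ew : (econs e w) => [v|] //=; case: eqP => // uv.
  by move: ew; rewrite -uv -ecutP eu => -[].
case ew : (econs e w) => [v|] //=; case: eqP => // uv.
by move: ew; rewrite -uv -ecutP eu.
Qed.

Lemma Lvertex_xi x w : Lvertex x (xi w) = if prng w == x then xi w else 0.
Proof.
apply/val_inj/funext => u /=; rewrite /vcut.
case: (eqVneq u w) => [->|uw]; first by case: ifP => _ /=; rewrite ?eqxx.
by case: ifP => _ /=; rewrite ?(negPf uw)//; case: ifP => //= _; rewrite (negPf uw).
Qed.

Definition generators : set (H -> H) := range Ledge `|` range Lvertex.

Definition graph_norm_algebra : set (H -> H) := norm_closed_algebra generators.

Definition graph_wot_algebra : set (H -> H) := wot_closed_algebra generators.

End GraphAlgebras.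

(* Main.v *)
Require Import Defs.
From Stdlib Require Import Relations.
From mathcomp Require Import all_boot all_order all_algebra.
From mathcomp Require Import complex ring lra zify.
From mathcomp Require Import all_classical all_reals ereal esum numfun.

(** The assumption is applied to explicit derivations. A bounded operator N on
    the path space whose commutators with the generators lie in the algebra
    implements a bounded derivation ([bounded_derivation_commutator]). If it is
    also implemented by T in the weak-operator closed algebra, the Fourier
    coefficients of T, which commutes with right creation operators, satisfy
    linear relations prescribed by N ([implemented_coefficients]). Two kinds of
    N are enough.

    Call an edge e cyclic if it lies on a directed cycle. A non-cyclic edge occurs
    at most once in a path, so for closed walks b and c at the range and the source
    of e, the map xi_(u e v) |-> xi_(u b e c v) is a partial isometry. Its
    relations ([insertion_coefficients]) say, for b and c empty, that e is a bridge
    of the underlying undirected graph; for b and c both of positive length, they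
    are contradictory; and for one of them of positive length, they force every
    edge that touches this cycle to be e or an edge of the cycle. These facts are
    collected in [rigid]. They imply that in a connected graph that is not strongly
    connected the strongly connected classes with an edge are circles, each hanging
    on one non-cyclic edge, and that the non-cyclic edges form a tree: this is
    [rigid_generalized_fruit_tree].

    For the alternating numbers, let d x be the least number of directed paths, run
    in either direction, that join x to a vertex chosen in its component. Since d
    varies by at most one along a directed path, the diagonal operator with entries
    d (s w) - d (r w) is bounded, and so is a function with the same coboundary
    as d; hence d is bounded by one constant for all components
    ([inner_zigzag_bounded]). On the other hand, a directed path cannot cross two
    of the bridges that follow turns of a line away from the circles, so a zigzag
    between the ends of the line needs as many directed paths as there are such
    turns ([rigid_nb_alternating]). *)

Set Implicit Arguments.
Unset Strict Implicit.
Unset Printing Implicit Defensive.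

Import Order.TTheory GRing.Theory Num.Theory.

Local Open Scope classical_set_scope.
Local Open Scope ring_scope.

(** * Bounded operators on a square-summable sequence space *)

Section Hilbert.
Context {R : realType} {W : choiceType}.
Local Notation H := (ell2 R W).
Local Notation normc := (@Normc.normc R).
Implicit Types (f g : H) (S T N : H -> H).

Lemma sqsum_fin f : sqsum f \is a fin_num.
Proof. by rewrite ge0_fin_numE ?sqsum_ge0//; have := ell2_valP f; rewrite inE. Qed.

Lemma norm2_ge0 f : 0 <= norm2 f.
Proof. exact: sqrtr_ge0. Qed.

Lemma norm2_sqr f : (norm2 f ^+ 2)%:E = sqsum f.
Proof. by rewrite sqr_sqrtr ?fine_ge0 ?sqsum_ge0// fineK// sqsum_fin. Qed.

Lemma norm2Z_le (k : R[i]) f : norm2 (k *: f) <= normc k * norm2 f.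
Proof.
rewrite -ler_sqr ?nnegrE ?mulr_ge0 ?normc_ge0 ?norm2_ge0// exprMn.
by rewrite -lee_fin [X in (_ <= X)%E]EFinM !norm2_sqr; exact: sqsumZ_le.
Qed.

(** The triangle inequality up to a factor 2. It only serves to bound operators
    and to pass to limits, where the value of the constant is irrelevant. *)
Lemma norm2D_le f g : norm2 (f + g) <= 2 * (norm2 f + norm2 g).
Proof.
have h : norm2 (f + g) ^+ 2 <= norm2 f ^+ 2 + norm2 f ^+ 2 +
    (norm2 g ^+ 2 + norm2 g ^+ 2).
  by rewrite -lee_fin !EFinD !norm2_sqr; exact: sqsumD_le.
have f0 := norm2_ge0 f; have g0 := norm2_ge0 g.
rewrite -ler_sqr ?nnegrE ?norm2_ge0//; first by nra.
by rewrite mulr_ge0// addr_ge0.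
Qed.

Lemma normc_le_norm2 f w : normc (f w) <= norm2 f.
Proof.
rewrite -ler_sqr ?nnegrE ?normc_ge0 ?norm2_ge0// -lee_fin norm2_sqr.
apply: esum_ge; exists [set w]; first by split.
by rewrite fsbig_set1.
Qed.

Lemma norm2_xi w : norm2 (xi w : H) <= 1.
Proof.
rewrite -ler_sqr ?nnegrE ?norm2_ge0// expr1n -lee_fin norm2_sqr /sqsum.
rewrite (_ : esum _ _ = \esum_(v in [set w]) (1 : R)%:E).
  by rewrite esum_set1 ?lee_fin.
rewrite [RHS]esum_mkcond; apply: eq_esum => v _.
rewrite (_ : (v \in [set w]) = (v == w)); last by apply/idP/eqP; rewrite inE.
rewrite /=; case: ifP => _; first by rewrite Normc.normc1 expr1n.
by rewrite Normc.normc0 expr0n.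
Qed.

Lemma rsum_single (a : W -> R) w : (forall v, v != w -> a v = 0) -> rsum a = a w.
Proof.
move=> a0.
have part (F : W -> \bar R) : (forall v, v != w -> F v = 0%E) -> (0 <= F w)%E ->
    \esum_(v in [set: W]) F v = F w.
  move=> F0 Fw; rewrite -(esum_set1 Fw) [RHS]esum_mkcond; apply: eq_esum => v _.
  rewrite (_ : (v \in [set w]) = (v == w)); last by apply/idP/eqP; rewrite inE.
  by case: (eqVneq v w) => [->|/F0].
rewrite /rsum !part.
- rewrite funeposE funenegE /= -!EFin_max /=.
  case: (leP (a w) 0) => aw.
    by rewrite max_l ?oppr_ge0// sub0r opprK.
  by rewrite max_r ?subr0// oppr_le0 ltW.
- by move=> v /a0 av; rewrite funenegE /= av oppr0 maxxx.
- by rewrite funeneg_ge0.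
- by move=> v /a0 av; rewrite funeposE /= av maxxx.
- by rewrite funepos_ge0.
Qed.

(** Matrix entries against basis vectors are evaluations, which makes every
    coordinate continuous for the weak operator topology. *)
Lemma dotp_xi f w : dotp f (xi w) = f w.
Proof.
rewrite /dotp /csum.
have off v : v != w -> f v * ((xi w : H) v)^*%C = 0.
  by move=> vw; rewrite /= (negPf vw) conjc0 mulr0.
rewrite !(@rsum_single _ w); last by move=> v /off ->.
  by rewrite /= eqxx conjc1 mulr1; case: (f w).
by move=> v /off ->.
Qed.

Lemma bounded_opP T : bounded_op T ->
  linear T /\ exists2 M : R, 0 <= M & forall f, norm2 (T f) <= M * norm2 f.
Proof.
move=> [lT [M TM]]; split=> //; exists `|M| => // f.
by apply: le_trans (TM f) _; rewrite ler_wpM2r ?norm2_ge0 ?ler_norm.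
Qed.

Lemma bounded_op0 : bounded_op (0 : H -> H).
Proof.
split; first by move=> k f g; rewrite /= scaler0 addr0.
exists 0 => f; rewrite mul0r.
rewrite -[0 f]/(0 : H) -(scale0r (0 : H)).
by apply: le_trans (norm2Z_le _ _) _; rewrite Normc.normc0 mul0r.
Qed.

Lemma bounded_op_lin (c : R[i]) S T :
  bounded_op S -> bounded_op T -> bounded_op (c *: S + T).
Proof.
move=> /bounded_opP[lS [M M0 SM]] /bounded_opP[lT [M' M'0 TM]]; split.
  move=> k f g; rewrite -![(c *: S + T) _]/(c *: S _ + T _) lS lT !scalerDr.
  by rewrite !scalerA [k * c]mulrC -!addrA; congr (_ + _); rewrite addrCA.
exists (2 * (normc c * M + M')) => f.
rewrite -[(c *: S + T) f]/(c *: S f + T f).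
apply: le_trans (norm2D_le _ _) _; rewrite -mulrA ler_pM2l// mulrDl.
apply: lerD => //; apply: le_trans (norm2Z_le _ _) _.
by rewrite -mulrA ler_wpM2l ?normc_ge0.
Qed.

Lemma bounded_op_comp S T : bounded_op S -> bounded_op T -> bounded_op (S \o T).
Proof.
move=> /bounded_opP[lS [M M0 SM]] /bounded_opP[lT [M' M'0 TM]]; split.
  by move=> k f g; rewrite /= lT lS.
exists (M * M') => f /=; apply: le_trans (SM _) _.
by rewrite -mulrA ler_wpM2l.
Qed.

Lemma subalgebra_bounded : subalgebra (@bounded_op R W).
Proof.
split=> //.
- exact: bounded_op0.
- by move=> c S T; exact: bounded_op_lin.
- by move=> S T; exact: bounded_op_comp.
Qed.

Lemma subalgebraB (A : set (H -> H)) S T :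
  subalgebra A -> A S -> A T -> A (S - T).
Proof.
move=> [_ _ lA _] AS AT; rewrite addrC -scaleN1r; exact: lA.
Qed.

Lemma bounded_opB S T : bounded_op S -> bounded_op T -> bounded_op (S - T).
Proof. exact: subalgebraB subalgebra_bounded. Qed.

Lemma linear_op0 T : linear T -> T 0 = 0.
Proof. by move=> lT; have := lT (-1) 0 0; rewrite scaler0 addr0 scaleN1r addNr. Qed.

Lemma linear_opD T f g : linear T -> T (f + g) = T f + T g.
Proof. by move=> lT; rewrite -[f in LHS]scale1r lT scale1r. Qed.

Lemma linear_opZ T k f : linear T -> T (k *: f) = k *: T f.
Proof. by move=> lT; rewrite -[X in T X]addr0 lT linear_op0// addr0. Qed.

Lemma linear_opB T f g : linear T -> T (f - g) = T f - T g.
Proof.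
by move=> lT; rewrite linear_opD// -scaleN1r linear_opZ// scaleN1r.
Qed.

Lemma opnorm_bound T f : bounded_op T -> norm2 (T f) <= opnorm T * norm2 f.
Proof.
move=> /bounded_opP[lT [M M0 TM]].
have ub g : norm2 g <= 1 -> norm2 (T g) <= opnorm T.
  move=> g1; apply: ub_le_sup; last by exists g.
  exists M => _ [g' g'1 <-]; apply: le_trans (TM _) _.
  by rewrite -[leRHS]mulr1 ler_wpM2l.
have [f0|f0] := eqVneq (norm2 f) 0.
  by have := TM f; rewrite f0 !mulr0.
have fp : 0 < norm2 f by rewrite lt_neqAle eq_sym f0 norm2_ge0.
pose k : R[i] := ((norm2 f)%:C)%C.
have nk : normc k = norm2 f.
  by rewrite /k /= expr0n addr0 sqrtr_sqr ger0_norm ?norm2_ge0.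
have k0 : k != 0.
  by apply/eqP => /(congr1 normc); rewrite nk Normc.normc0 => /eqP; rewrite (negPf f0).
have -> : T f = k *: T (k^-1 *: f).
  by rewrite linear_opZ// scalerA mulfV// scale1r.
apply: le_trans (norm2Z_le _ _) _; rewrite nk mulrC ler_pM2r//.
apply: ub; apply: le_trans (norm2Z_le _ _) _.
have : normc k * normc k^-1 = 1 by rewrite -Normc.normcM mulfV// Normc.normc1.
rewrite nk => h; rewrite mulrC h //.
Qed.

Lemma opnorm_ge0 T : bounded_op T -> 0 <= opnorm T.
Proof.
move=> bT; have n0 : norm2 (0 : H) = 0.
  apply/eqP; rewrite eq_le norm2_ge0 andbT -(scale0r (0 : H)).
  by apply: le_trans (norm2Z_le _ _) _; rewrite Normc.normc0 mul0r.
have /bounded_opP[_ [M M0 TM]] := bT.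
apply: le_trans (norm2_ge0 (T 0)) _; apply: ub_le_sup; last by exists 0; rewrite //= n0.
exists M => _ [g' g'1 <-]; apply: le_trans (TM _) _.
by rewrite -[leRHS]mulr1 ler_wpM2l.
Qed.

Lemma opnorm_le T (M : R) : 0 <= M ->
  (forall f, norm2 (T f) <= M * norm2 f) -> opnorm T <= M.
Proof.
move=> M0 TM; apply: ge_sup.
  exists (norm2 (T 0)); exists 0 => //=; rewrite -(scale0r (0 : H)).
  by apply: le_trans (norm2Z_le _ _) _; rewrite Normc.normc0 mul0r.
move=> _ [f f1 <-]; apply: le_trans (TM _) _.
by rewrite -[leRHS]mulr1 ler_wpM2l.
Qed.

Definition commutator N T : H -> H := (N \o T) - (T \o N).

Lemma commutator_lin N c S T : linear N ->
  commutator N (c *: S + T) = c *: commutator N S + commutator N T.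
Proof.
move=> lN; apply/funext => f; rewrite /commutator.
rewrite -[LHS]/(N (c *: S f + T f) - (c *: S (N f) + T (N f))) lN.
rewrite -[RHS]/(c *: (N (S f) - S (N f)) + (N (T f) - T (N f))).
by rewrite scalerBr opprD addrACA.
Qed.

Lemma commutatorM N S T : linear N -> linear S ->
  commutator N (S \o T) = (commutator N S \o T) + (S \o commutator N T).
Proof.
move=> lN lS; apply/funext => f; rewrite /commutator.
rewrite -[LHS]/(N (S (T f)) - S (T (N f))).
rewrite -[RHS]/(N (S (T f)) - S (N (T f)) + S (N (T f) - T (N f))).
by rewrite linear_opB// addrA addrNK.
Qed.

Lemma bounded_commutator N T :
  bounded_op N -> bounded_op T -> bounded_op (commutator N T).
Proof. by move=> bN bT; apply: bounded_opB; exact: bounded_op_comp. Qed.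

Lemma opnorm_commutator_le N : bounded_op N ->
  exists2 M : R, 0 < M &
    forall T, bounded_op T -> opnorm (commutator N T) <= M * opnorm T.
Proof.
move=> bN; have /bounded_opP[lN [K K0 NK]] := bN.
exists (4 * K + 1) => [|T bT]; first by lra.
have T0 := opnorm_ge0 bT.
apply: opnorm_le => [|f]; first by rewrite mulr_ge0//; lra.
rewrite /commutator -[X in norm2 X]/(N (T f) - T (N f)).
apply: le_trans (norm2D_le _ _) _.
have h1 : norm2 (N (T f)) <= K * opnorm T * norm2 f.
  by apply: le_trans (NK _) _; rewrite -mulrA ler_wpM2l// opnorm_bound.
have h2 : norm2 (- T (N f)) <= K * opnorm T * norm2 f.
  rewrite -scaleN1r; apply: le_trans (norm2Z_le _ _) _.
  rewrite /= oppr0 expr0n addr0 sqrrN expr1n sqrtr1 mul1r; apply: le_trans (opnorm_bound _ bT) _.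
  by rewrite [K * _]mulrC -mulrA ler_wpM2l.
have := mulr_ge0 T0 (norm2_ge0 f); nra.
Qed.

End Hilbert.

(** * Derivations implemented by a bounded operator *)

Section GeneratedAlgebra.
Context {R : realType} {W : choiceType}.
Local Notation H := (ell2 R W).
Variable X : set (H -> H).
Hypothesis X_bounded : X `<=` @bounded_op R W.

Lemma norm_closed_algebra_subalgebra : subalgebra (norm_closed_algebra X).
Proof.
split.
- apply: smallest_sub => //; split=> [|T bT _]//; exact: subalgebra_bounded.
- by move=> A [[[_ A0 _ _] _] _].
- by move=> c S T hS hT A hA; case: (hA) => [[[_ _ lA _] _] _]; apply: lA;
    [exact: hS | exact: hT].
- by move=> S T hS hT A hA; case: (hA) => [[[_ _ _ mA] _] _]; apply: mA;
    [exact: hS | exact: hT].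
Qed.

Lemma norm_closed_algebra_closed : norm_closed (norm_closed_algebra X).
Proof.
move=> T bT Tlim A hA; case: (hA) => [[_ cA] _]; apply: cA => // e /Tlim[S hS Se].
by exists S => //; exact: hS.
Qed.

Lemma sub_norm_closed_algebra : X `<=` norm_closed_algebra X.
Proof. exact: sub_gen_smallest. Qed.

(** The operators of the algebra whose commutator with [N] stays in the algebra
    form a norm-closed subalgebra, by the Leibniz rule and by the norm continuity
    of the commutator; so only the generators have to be tested. *)
Lemma commutator_norm_closed_algebra N : bounded_op N ->
  (forall T, X T -> norm_closed_algebra X (commutator N T)) ->
  forall T, norm_closed_algebra X T -> norm_closed_algebra X (commutator N T).
Proof.
move=> bN NX; have /bounded_opP[lN _] := bN.
have sA := norm_closed_algebra_subalgebra; have [bA A0 lA mA] := sA.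
suff : norm_closed_algebra X `<=` norm_closed_algebra X `&`
    [set T | norm_closed_algebra X (commutator N T)].
  by move=> h T /h[].
apply: smallest_sub; last first.
  by move=> T XT; split; [exact: sub_norm_closed_algebra | exact: NX].
split; [split|].
- by move=> T [/bA].
- split=> //=; rewrite (_ : commutator N 0 = 0)//.
  apply/funext => f; rewrite /commutator -[LHS]/(N 0 - 0).
  by rewrite linear_op0// subr0.
- by move=> c S T [? ?] [? ?]; split; rewrite /= ?commutator_lin//; exact: lA.
- move=> S T [hS cS] [hT cT]; split; first exact: mA.
  have /bounded_opP[lS _] := bA _ hS.
  rewrite /= commutatorM// -[_ \o T]scale1r; apply: lA; exact: mA.
- move=> T bT Tlim; split.
    by apply: norm_closed_algebra_closed => // e /Tlim[S [hS _] Se]; exists S.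
  apply: norm_closed_algebra_closed; first exact: bounded_commutator.
  move=> e e0; have [M M0 NM] := opnorm_commutator_le bN.
  have /Tlim[S [hS cS] Se] : 0 < e / M by rewrite divr_gt0.
  exists (commutator N S) => //.
  have -> : commutator N T - commutator N S = commutator N (T - S).
    by rewrite addrC -scaleN1r -commutator_lin// scaleN1r addrC.
  apply: le_lt_trans (NM _ _) _; first by apply: bounded_opB => //; exact: bA.
  by rewrite mulrC -ltr_pdivlMr.
Qed.

Lemma bounded_derivation_commutator N : bounded_op N ->
  (forall T, X T -> norm_closed_algebra X (commutator N T)) ->
  bounded_derivation (norm_closed_algebra X) (commutator N).
Proof.
move=> bN NX; have /bounded_opP[lN _] := bN.
have [bA _ _ _] := norm_closed_algebra_subalgebra.
split.
- exact: commutator_norm_closed_algebra.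
- by move=> c S T _ _; exact: commutator_lin.
- by move=> S T /bA/bounded_opP[lS _] _; exact: commutatorM.
- have [M M0 NM] := opnorm_commutator_le bN.
  by exists M => T /bA; exact: NM.
Qed.

End GeneratedAlgebra.

(** * Walks, paths and their end cuts *)

Section Walks.
Variable G : digraph.
Implicit Types (x y z : vertex G) (e f : edge G) (b c l u v : seq (edge G)).
Implicit Types (p q w : dipath G).

Definition reach : vertex G -> vertex G -> Prop := clos_refl_trans _ (@adjacent G).

(** Equivalently, [e] lies on a directed cycle. *)
Definition cyclic e : Prop := reach (rng e) (src e).

(** [l] lists the edges of a path with range [x] and source [y]: as in the
    products e_1 ... e_n, a walk is read from its range to its source. *)
Definition walk x l y : bool := chain x l && (last x (map src l) == y).

Lemma reach_refl x : reach x x. Proof. exact: rt_refl. Qed.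

Lemma reach_trans y x z : reach x y -> reach y z -> reach x z.
Proof. exact: rt_trans. Qed.

Lemma reach_edge e : reach (src e) (rng e).
Proof. by apply: rt_step; exists e. Qed.

Lemma chain_cat x l l' :
  chain x (l ++ l') = chain x l && chain (last x (map src l)) l'.
Proof. by elim: l x => //= e l IH x; rewrite IH andbA. Qed.

Lemma walk_cat x l l' z :
  walk x (l ++ l') z = walk x l (last x (map src l)) && walk (last x (map src l)) l' z.
Proof. by rewrite /walk chain_cat map_cat last_cat eqxx andbT andbA. Qed.

Lemma walk_cons x e l y : walk x (e :: l) y = (rng e == x) && walk (src e) l y.
Proof. by rewrite /walk /= andbA. Qed.

Lemma walkI x l l' y z : walk x l y -> walk y l' z -> walk x (l ++ l') z.
Proof. by move=> xy; have /andP[_ /eqP yE] := xy; rewrite walk_cat yE xy. Qed.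

Lemma walk_reach x l y : walk x l y -> reach y x.
Proof.
elim: l x => [|e l IH] x; first by move=> /eqP <-; exact: reach_refl.
rewrite walk_cons => /andP[/eqP <- /IH]; move=> h.
exact: reach_trans h (reach_edge e).
Qed.

Lemma walk_mem x l y e : walk x l y -> e \in l -> reach y (src e) /\ reach (rng e) x.
Proof.
move=> xy /path.splitPr h; case: h xy => u v.
rewrite walk_cat walk_cons => /andP[ux /andP[/eqP -> vy]].
by split; [exact: walk_reach vy | exact: walk_reach ux].
Qed.

Lemma reach_walk x y : reach x y -> exists l, walk y l x.
Proof.
elim=> [{}x {}y [e [<- <-]]|{}x|{}x z {}y _ [l xl] _ [l' zl']].
- by exists [:: e]; rewrite walk_cons /walk !eqxx.
- by exists [::]; rewrite /walk /= eqxx.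
- by exists (l' ++ l); exact: walkI zl' xl.
Qed.

Lemma closed_walk_cyclic x b e : walk x b x -> e \in b -> cyclic e.
Proof. by move=> xb /(walk_mem xb)[h h']; exact: reach_trans h' h. Qed.

(** Between two occurrences of [e], the path would lead from the range of [e]
    back to its source. *)
Lemma noncyclic_once x u e v y : ~ cyclic e -> walk x (u ++ e :: v) y ->
  (e \notin u) && (e \notin v).
Proof.
move=> ne; rewrite walk_cat walk_cons => /andP[ux /andP[/eqP re vy]].
apply/andP; split; apply/negP.
  by move=> /(walk_mem ux)[]; rewrite -re.
by move=> /(walk_mem vy)[].
Qed.

Lemma split_unique (T : eqType) (a : T) (r s r' s' : seq T) :
  a \notin r -> a \notin r' -> r ++ a :: s = r' ++ a :: s' -> r = r' /\ s = s'.
Proof.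
elim: r r' => [|k r IH] [|k' r'] //=; rewrite ?inE ?negb_or.
- by move=> _ _ [].
- by move=> _ /andP[/eqP ak _] [].
- by move=> /andP[/eqP ak _] _ [/esym].
- by move=> /andP[_ ar] /andP[_ ar'] [-> /(IH _ ar ar')[-> ->]].
Qed.

Lemma option_ext (T : Type) (a a' : option T) :
  (forall k, a = Some k <-> a' = Some k) -> a = a'.
Proof.
case: a => [k|]; first by move=> h; apply/esym/h.
by case: a' => // k h; apply/h.
Qed.

Lemma dipath_walk p : walk (prng p) (val p).2 (psrc p).
Proof. by rewrite /walk eqxx andbT; exact: valP p. Qed.

Lemma dipath_inj p q : (val p).1 = (val q).1 -> (val p).2 = (val q).2 -> p = q.
Proof.
move=> h1 h2; apply/val_inj.
by rewrite [LHS]surjective_pairing [RHS]surjective_pairing h1 h2.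
Qed.

Definition vpath x : dipath G := @Dipath G (x, [::]) isT.

Lemma epath_subproof e : chain (rng e) [:: e].
Proof. by rewrite /= eqxx. Qed.

Definition epath e : dipath G := @Dipath G (rng e, [:: e]) (epath_subproof e).

Lemma ecutE e q p : ecut e q = Some p <->
  [/\ (val q).1 = rng e, (val q).2 = e :: (val p).2 & (val p).1 = src e].
Proof.
rewrite ecutP; split=> [/econsP/and3P[/eqP ? /eqP ? /eqP ?]//|[h1 h2 h3]].
by apply/econsP/and3P; split; apply/eqP.
Qed.

(** The right-handed analogue of [ecut]: [Some p] if [q] is the product p f. *)
Definition rcut f q : option (dipath G) :=
  if (val q).2 is e :: l then
    if last e l == f then insub ((val q).1, belast e l) else None
  else None.

Lemma rcutE f q p : rcut f q = Some p <->
  (val q).1 = (val p).1 /\ (val q).2 = rcons (val p).2 f.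
Proof.
rewrite /rcut; split.
  case El : (val q).2 => [|e l]//; case: eqP => // lf.
  case: insubP => // p' _ p'E [<-].
  by rewrite p'E /=; split=> //; rewrite lastI lf.
move=> [h1 h2]; rewrite h2.
case E : (rcons (val p).2 f) => [|e l]; first by move: E; case: (val p).2.
have : rcons (belast e l) (last e l) = rcons (val p).2 f by rewrite -lastI E.
move=> /rcons_inj[-> ->]; rewrite eqxx.
have pE : ((val q).1, (val p).2) = val p by rewrite h1 -surjective_pairing.
by rewrite pE valK.
Qed.

Lemma rcut_inj f p q w : rcut f p = Some w -> rcut f q = Some w -> p = q.
Proof.
by move=> /rcutE[h1 h2] /rcutE[h3 h4]; apply: dipath_inj; rewrite ?h1 ?h2.
Qed.

(** Left and right cuts act on opposite ends of a path. The case to watch is a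
    path of length one, where both sides are [None]. *)
Lemma ecut_rcut e f q : obind (rcut f) (ecut e q) = obind (ecut e) (rcut f q).
Proof.
apply: option_ext => p; split.
  case E : (ecut e q) => [m|]//= F.
  move/ecutE: E => [h1 h2 h3]; move/rcutE: F => [h4 h5].
  have mc : chain (rng e) (e :: (val p).2).
    have := valP q; rewrite h1 h2 h5 -rcons_cons -cats1 chain_cat.
    by move=> /andP[].
  rewrite (_ : rcut f q = Some (@Dipath G (rng e, e :: (val p).2) mc)).
    by apply/ecutE; split=> //=; rewrite -h4.
  by apply/rcutE; split => //=; rewrite h2 h5.
case E : (rcut f q) => [m|]//= F.
move/rcutE: E => [h1 h2]; move/ecutE: F => [h3 h4 h5].
have mc : chain (src e) (rcons (val p).2 f).
  by have := valP q; rewrite h1 h2 h3 h4 /= => /andP[].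
rewrite (_ : ecut e q = Some (@Dipath G (src e, rcons (val p).2 f) mc)).
  by apply/rcutE.
by apply/ecutE; split; rewrite //= ?h1 ?h2 ?h4.
Qed.

Lemma vcut_rcut x f q : obind (rcut f) (vcut x q) = obind (vcut x) (rcut f q).
Proof.
rewrite /vcut; case: ifPn => [qx|/negP qx] /=.
  case E : (rcut f q) => [m|]//=; move/rcutE: E => [h _].
  by rewrite /prng -h -/(prng _) qx.
case E : (rcut f q) => [m|]//=; move/rcutE: E => [h _].
by case: ifP => //; rewrite /prng -h -/(prng _) => /qx.
Qed.

Fixpoint lcuts l q : option (dipath G) :=
  if l is f :: l' then obind (lcuts l') (ecut f q) else Some q.

Lemma lcutsP l q w : lcuts l q = Some w <->
  (val q).2 = l ++ (val w).2 /\ (val w).1 = last (val q).1 (map src l).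
Proof.
elim: l q => [|f l IH] q /=.
  by split=> [[->]//|[h1 h2]]; congr Some; exact: dipath_inj.
split.
  case E : (ecut f q) => [m|]//= /IH[h1 h2]; move/ecutE: E => [h3 h4 h5].
  by rewrite h4 h1 h2 h5.
move=> [h1 h2].
have := valP q; rewrite h1 /= => /andP[/eqP fq mc].
rewrite (_ : ecut f q = Some (@Dipath G (src f, l ++ (val w).2) mc)).
  exact/IH.
by apply/ecutE; split.
Qed.

End Walks.

(** * Fourier coefficients of an implementing operator *)

Lemma ell2_ext (R : realType) (W : choiceType) (f g : ell2 R W) : f =1 g -> f = g.
Proof. by move=> fg; apply/val_inj/funext. Qed.

Lemma reindex_op_comp (R : realType) (W : choiceType) (c c' : W -> option W)
    (c_inj : forall u v w, c u = Some w -> c v = Some w -> u = v)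
    (c'_inj : forall u v w, c' u = Some w -> c' v = Some w -> u = v)
    (g : ell2 R W) q :
  reindex_op c_inj (reindex_op c'_inj g) q = oapp g 0 (obind c' (c q)).
Proof. by rewrite /=; case: (c q). Qed.

Section Coefficients.
Variables (R : realType) (G : digraph).
Local Notation H := (ell2 R (dipath G)).
Local Notation A_G := (@graph_norm_algebra R G).

Lemma normcN (z : R[i]) : Normc.normc (- z) = Normc.normc z.
Proof. by case: z => x y /=; rewrite !sqrrN. Qed.

(** The right creation operator, which maps xi_w to xi_(w f). *)
Definition Redge (f : edge G) : H -> H := reindex_op (@rcut_inj G f).

Lemma Redge_xi f : Redge f (xi (vpath (rng f))) = xi (epath f).
Proof.
apply: ell2_ext => q /=.
case E : (rcut f q) => [m|] /=.
  move/rcutE: E => [h1 h2]; congr (if _ then _ else _); apply/eqP/eqP.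
    by move=> mE; apply: dipath_inj; rewrite ?h1 ?h2 mE.
  move=> qE; apply: dipath_inj; rewrite -?h1 ?qE//=.
  by move: h2; rewrite qE /=; case: (val m).2 => // a [|].
case: eqP => // qE; rewrite (_ : rcut f q = Some (vpath (rng f))) // in E.
by apply/rcutE; rewrite qE.
Qed.

Lemma Ledge_xi_src f : Ledge f (xi (vpath (src f))) = xi (epath f) :> H.
Proof.
rewrite Ledge_xi (_ : econs f _ = Some (epath f))//.
by apply/econsP; rewrite /= /prng /= !eqxx.
Qed.

Lemma generators_bounded : @generators R G `<=` @bounded_op R (dipath G).
Proof. by move=> _ [[e _ <-]|[x _ <-]]; exact: bounded_reindex_op. Qed.

Lemma graph_norm_algebra_subalgebra : subalgebra A_G.
Proof. exact: norm_closed_algebra_subalgebra generators_bounded. Qed.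

Definition right_commutant : set (H -> H) :=
  [set T | bounded_op T /\ forall f g, T (Redge f g) = Redge f (T g)].

(** Left and right creation operators commute. That an operator commutes with
    [Redge f] is an equality of coordinates, and the coordinate [q] of
    [Redge f g] is the coordinate of [g] at the path obtained by cutting [f] from
    [q]; so the condition passes to limits in the weak operator topology. *)
Lemma graph_wot_algebra_right_commutant :
  @graph_wot_algebra R G `<=` right_commutant.
Proof.
apply: smallest_sub; last first.
  move=> _ [[e _ <-]|[x _ <-]]; split; try exact: bounded_reindex_op;
    move=> f g; apply: ell2_ext => q; rewrite !reindex_op_comp.
    by rewrite ecut_rcut.
  by rewrite vcut_rcut.
have linR f : linear (Redge f) by have [] := bounded_reindex_op (R := R) (@rcut_inj G f).
split; [split|].
- by move=> T [].
- split; first exact: bounded_op0.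
  by move=> f g; rewrite -[LHS]/(0 : H) -[X in _ = Redge f X]/(0 : H) linear_op0.
- move=> c S T [bS cS] [bT cT]; split; first exact: bounded_op_lin.
  move=> f g; rewrite -[LHS]/(c *: S (Redge f g) + T (Redge f g)).
  by rewrite -[X in _ = Redge f X]/(c *: S g + T g) linR cS cT.
- move=> S T [bS cS] [bT cT]; split; first exact: bounded_op_comp.
  by move=> f g; rewrite /= cT cS.
move=> T bT Tlim; split=> // f g; apply: ell2_ext => q.
apply/eqP; rewrite -subr_eq0; apply/eqP/Normc.eq0_normc/eqP.
rewrite eq_le normc_ge0 andbT; apply/ler_addgt0Pr => e e0; rewrite add0r.
have e20 : 0 < e / 2 by rewrite divr_gt0.
pose s : seq (H * H) := (Redge f g, xi q) :: oapp (fun w => [:: (g, xi w)]) [::] (rcut f q).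
have [S [bS cS] Ss] := Tlim s (e / 2) e20.
have h1 : Normc.normc (T (Redge f g) q - Redge f (S g) q) < e / 2.
  have /Ss : (Redge f g, xi q) \in s by rewrite /s inE eqxx.
  rewrite [X in dotp X _]/(T (Redge f g) - S (Redge f g)) [X in dotp _ X]/(xi q).
  by rewrite dotp_xi cS.
have h2 : Normc.normc (Redge f (S g) q - Redge f (T g) q) < e / 2.
  rewrite /=; case E : (rcut f q) => [w|]; last first.
    by rewrite [oapp _ _ _]/= subrr Normc.normc0.
  have /Ss : (g, xi w) \in s by rewrite /s E !inE eqxx orbT.
  rewrite [X in dotp X _]/(T g - S g) [X in dotp _ X]/(xi w) dotp_xi => h.
  apply: le_lt_trans h; rewrite -[oapp (S g) _ _]/(S g w) -[oapp (T g) _ _]/(T g w).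
  by rewrite -[X in _ <= Normc.normc X]/(T g w - S g w) -normcN opprB.
rewrite -[leLHS]/(Normc.normc (T (Redge f g) q - Redge f (T g) q)).
rewrite -(subrK (Redge f (S g) q) (T (Redge f g) q)) -addrA.
apply: le_trans (le_normcD _ _) _; rewrite (splitr e).
by apply: lerD; exact: ltW.
Qed.

Definition all_derivations_inner : Prop :=
  forall d, bounded_derivation A_G d ->
     exists2 T, @graph_wot_algebra R G T &
       forall A, A_G A -> d A = inner_derivation T A.

(** This is how the assumption on derivations is used. If [T] implements the
    commutator with [N], put [t x w] for the coefficient of T xi_x at w. Then
    L_f T xi_x has coefficient [t x] at the left cut of a path, where x is the
    source of f, while T L_f xi_x = T R_f xi_y = R_f T xi_y, where y is the range
    of f, has coefficient [t y] at its right cut. Hence an explicit [N] prescribes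
    linear relations between the coefficients [t]; the diagonal ones are bounded
    by the norm of [T]. *)
Lemma implemented_coefficients N : all_derivations_inner -> bounded_op N ->
  (forall f, A_G (commutator N (Ledge f))) ->
  (forall x, A_G (commutator N (Lvertex x))) ->
  exists (t : vertex G -> dipath G -> R[i]) (K : R),
    (forall x, Normc.normc (t x (vpath x)) <= K) /\
    forall f v, commutator N (Ledge f) (xi (vpath (src f))) v =
      oapp (t (src f)) 0 (ecut f v) - oapp (t (rng f)) 0 (rcut f v).
Proof.
move=> hder bN NE NV.
have [|T] := hder (commutator N).
  apply: (bounded_derivation_commutator generators_bounded) => //.
  by move=> _ [[e _ <-]|[x _ <-]]; [exact: NE | exact: NV].
move=> /graph_wot_algebra_right_commutant[bT cT] NT.
have /bounded_opP[lT [M M0 TM]] := bT.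
exists (fun x => T (xi (vpath x))), M; split.
  move=> x; apply: le_trans (normc_le_norm2 _ _) _; apply: le_trans (TM _) _.
  by rewrite -[leRHS]mulr1 ler_wpM2l// norm2_xi.
move=> f v; rewrite NT; last by apply: sub_norm_closed_algebra; left; exists f.
rewrite /inner_derivation.
rewrite -[LHS]/(Ledge f (T (xi (vpath (src f)))) v - T (Ledge f (xi (vpath (src f)))) v).
by rewrite Ledge_xi_src -Redge_xi cT.
Qed.

Definition Lpath (l : seq (edge G)) : H -> H :=
  foldr (fun f T => Ledge f \o T) id l.

Lemma LpathE l g q : Lpath l g q = oapp g 0 (lcuts l q).
Proof.
elim: l q => [|f l IH] q //=; case: (ecut f q) => //= m; exact: IH.
Qed.

Lemma Lpath_mem f l : A_G (Lpath (f :: l)).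
Proof.
have [_ _ _ mA] := graph_norm_algebra_subalgebra.
have LE e : A_G (Ledge e) by apply: sub_norm_closed_algebra; left; exists e.
elim: l f => [|f' l IH] f; [exact: LE |].
by apply: mA; [exact: LE | exact: IH].
Qed.

End Coefficients.

(** * Insertion of cycles around a non-cyclic edge *)

Section Insertion.
(* A path contains the non-cyclic edge [e] at most once, so it is uniquely of the
   form u e v. For closed walks [b] at the range and [c] at the source of [e], the
   map u e v |-> u b e c v is then an injective partial map on paths, and defines
   a partial isometry whose commutators with the generators are all zero except
   [N, L_e] = L_(b e c). *)
Variables (R : realType) (G : digraph) (e : edge G) (b c : seq (edge G)).
Hypotheses (ne : ~ cyclic e) (walkb : walk (rng e) b (rng e)).
Hypothesis walkc : walk (src e) c (src e).
Local Notation H := (ell2 R (dipath G)).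
Local Notation A_G := (@graph_norm_algebra R G).

Definition inserted (q p : dipath G) : Prop := exists u v,
  [/\ e \notin u, (val p).2 = u ++ e :: v, (val q).1 = (val p).1
    & (val q).2 = (u ++ b) ++ e :: c ++ v].

Lemma notin_b : e \notin b.
Proof. by apply/negP => /(closed_walk_cyclic walkb)/ne. Qed.

Lemma inserted_injl q p p' : inserted q p -> inserted q p' -> p = p'.
Proof.
move=> [u [v [eu p2 q1 q2]]] [u' [v' [eu' p2' q1' q2']]].
apply: dipath_inj; first by rewrite -q1.
have /(split_unique _ _)[] : (u ++ b) ++ e :: (c ++ v) = (u' ++ b) ++ e :: (c ++ v').
- by rewrite -q2.
- by rewrite mem_cat negb_or eu notin_b.
- by rewrite mem_cat negb_or eu' notin_b.
rewrite p2 p2' => /eqP ub /eqP cv.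
have su : size u = size u'.
  by move/eqP: ub => /(congr1 size); rewrite !size_cat => /addIn.
move: ub; rewrite eqseq_cat// => /andP[/eqP -> _].
by move: cv; rewrite eqseq_cat// => /andP[_ /eqP ->].
Qed.

Lemma inserted_injr q q' p : inserted q p -> inserted q' p -> q = q'.
Proof.
move=> [u [v [eu p2 q1 q2]]] [u' [v' [eu' p2' q1' q2']]].
apply: dipath_inj; first by rewrite q1.
have [uu vv] := split_unique eu eu' (etrans (esym p2) p2').
by rewrite q2 q2' uu vv.
Qed.

Definition uninsert (q : dipath G) : option (dipath G) :=
  if pselect (exists p, inserted q p) is left h then Some (projT1 (cid h)) else None.

Lemma uninsertP q p : uninsert q = Some p <-> inserted q p.
Proof.
rewrite /uninsert; case: pselect => [h|h]; last first.
  by split=> // qp; case: h; exists p.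
case: cid => p' /= qp'; split=> [[<-]//|qp]; congr Some; exact: inserted_injl qp' qp.
Qed.

Lemma uninsert_inj q q' p : uninsert q = Some p -> uninsert q' = Some p -> q = q'.
Proof. by rewrite !uninsertP; exact: inserted_injr. Qed.

Definition insert_op : H -> H := reindex_op uninsert_inj.

(** A path starting with [f], different from [e], is modified behind [f] only. *)
Lemma ecut_uninsert f q : f != e ->
  obind (ecut f) (uninsert q) = obind uninsert (ecut f q).
Proof.
move=> fe; apply: option_ext => w; split.
  case E : (uninsert q) => [p|]//= /ecutE[h1 h2 h3].
  move/uninsertP: E => [[|f' u] [v [eu p2 q1 q2]]].
    by move: p2; rewrite h2 => -[/eqP]; rewrite (negPf fe).
  move: p2 q2 eu; rewrite h2 /= => -[<- wE] q2; rewrite inE negb_or => /andP[_ eu].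
  have := valP q; rewrite q2 /= => /andP[_ mc].
  rewrite (_ : ecut f q = Some (@Dipath G (src f, (u ++ b) ++ e :: c ++ v) mc)) /=.
    by apply/uninsertP; exists u, v; split.
  by apply/ecutE; split=> //=; rewrite q1.
case E : (ecut f q) => [m|]//= /uninsertP[u [v [eu p2 q1 q2]]].
move/ecutE: E => [h1 h2 h3].
have pc : chain (rng f) (f :: (val w).2).
  by rewrite /= eqxx -h3 q1; exact: valP w.
rewrite (_ : uninsert q = Some (@Dipath G (rng f, f :: (val w).2) pc)) /=.
  by apply/ecutE; split=> //=; rewrite -q1.
apply/uninsertP; exists (f :: u), v; split=> //=.
- by rewrite inE negb_or eq_sym fe.
- by rewrite p2.
- by rewrite h2 q2.
Qed.

(** If u e v starts with [e] then u is empty, and u b e c v starts with the block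
    b e c. *)
Lemma ecut_uninsert_self q :
  obind (ecut e) (uninsert q) = lcuts (b ++ e :: c) q.
Proof.
apply: option_ext => w; rewrite lcutsP; split.
  case E : (uninsert q) => [p|]//= /ecutE[h1 h2 h3].
  move/uninsertP: E => [u [v [eu p2 q1 q2]]].
  have [u0 vE] := @split_unique _ e [::] (val w).2 u v isT eu (etrans (esym h2) p2).
  rewrite q2 -u0 vE /= -catA /=; split=> //.
  rewrite h3 map_cat last_cat /=.
  by have /andP[_ /eqP ->] := walkc.
move=> [q2 w1].
have q1 : (val q).1 = rng e.
  have := valP q; rewrite q2 -catA; have := walkb; case: (b) => [|a l] /=.
    by move=> _ /andP[/eqP <-].
  by rewrite walk_cons => /andP[/eqP -> _] /andP[/eqP <-].
have w1' : (val w).1 = src e.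
  by move: w1; rewrite map_cat last_cat /=; have /andP[_ /eqP ->] := walkc.
have pc : chain (rng e) (e :: (val w).2).
  by rewrite /= eqxx -w1'; exact: valP w.
rewrite (_ : uninsert q = Some (@Dipath G (rng e, e :: (val w).2) pc)) /=.
  by apply/ecutE.
by apply/uninsertP; exists [::], (val w).2; split=> //; rewrite q2 -catA.
Qed.

(** A path that starts with [e] does not contain it a second time. *)
Lemma uninsert_ecut_self q : obind uninsert (ecut e q) = None.
Proof.
case E : (ecut e q) => [m|]//=; move/ecutE: E => [h1 h2 h3].
case F : (uninsert m) => [p|]//; move/uninsertP: F => [u [v [eu p2 q1 q2]]].
have := dipath_walk q; rewrite h2 => /(@noncyclic_once G _ [::] e _ _ ne) /=.
by rewrite q2 mem_cat inE eqxx orbT.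
Qed.

Lemma vcut_uninsert x q : obind (vcut x) (uninsert q) = obind uninsert (vcut x q).
Proof.
rewrite /vcut; case E : (uninsert q) => [p|] /=; last by case: ifP => //= _; rewrite E.
have /uninsertP[u [v [_ _ q1 _]]] := E.
by rewrite /prng q1; case: ifP => _ //=; rewrite E.
Qed.

Lemma commutator_insert_edge f :
  commutator insert_op (Ledge f) = if f == e then Lpath (b ++ e :: c) else 0.
Proof.
apply/funext => g; apply: ell2_ext => q.
rewrite /commutator -[LHS]/(insert_op (Ledge f g) q - Ledge f (insert_op g) q).
rewrite !reindex_op_comp; have [->|fe] := eqVneq f e.
  by rewrite uninsert_ecut_self subr0 ecut_uninsert_self LpathE.
by rewrite ecut_uninsert// subrr.
Qed.

Lemma commutator_insert_vertex x : commutator insert_op (Lvertex x) = 0.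
Proof.
apply/funext => g; apply: ell2_ext => q.
rewrite /commutator -[LHS]/(insert_op (Lvertex x g) q - Lvertex x (insert_op g) q).
by rewrite !reindex_op_comp vcut_uninsert subrr.
Qed.

(** The relations of [implemented_coefficients] for this partial isometry: the
    coefficients have a coboundary concentrated at the pair e, b e c. *)
Lemma insertion_coefficients : all_derivations_inner R G ->
  exists t : vertex G -> dipath G -> R[i], forall f v,
    ((f == e) && ((val v).2 == b ++ e :: c))%:R =
      oapp (t (src f)) 0 (ecut f v) - oapp (t (rng f)) 0 (rcut f v).
Proof.
move=> hder; have [bA A0 _ _] := graph_norm_algebra_subalgebra R G.
have bN : bounded_op insert_op by exact: bounded_reindex_op.
have [f|x|t [K [_ tE]]] := @implemented_coefficients R G insert_op hder bN.
- rewrite commutator_insert_edge; case: eqP => // _.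
  by case: b => [|a l] /=; exact: Lpath_mem.
- by rewrite commutator_insert_vertex.
exists t => f v; rewrite -tE commutator_insert_edge; case: (eqVneq f e) => //= ->.
rewrite LpathE; case E : (lcuts _ v) => [w|] /=.
  move/lcutsP: E => [h1 h2]; rewrite h1.
  rewrite -[X in (_ == X)%:R]cats0 eqseq_cat// eqxx /=; case: eqP => [w0|/eqP w0].
    rewrite (_ : w = vpath (src e)) ?eqxx//; apply: dipath_inj => //.
    by rewrite h2 map_cat last_cat /=; have /andP[_ /eqP ->] := walkc.
  by case: eqP => // wE; rewrite wE in w0.
case: eqP => // vE; rewrite (_ : lcuts _ v = Some (vpath (src e))) // in E.
apply/lcutsP; rewrite vE /= cats0; split=> //.
by rewrite map_cat last_cat /=; have /andP[_ /eqP ->] := walkc.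
Qed.

End Insertion.

(** * Derivations given by a vertex potential *)

Section Potential.
Variables (R : realType) (G : digraph) (d : vertex G -> nat).
(* Along a directed path the potential varies by at most one, so that
   N xi_w = (d (s w) - d (r w)) xi_w defines a difference of two projections. Its
   commutator with L_f is a multiple of L_f. *)
Hypothesis d_reach : forall x y, reach x y -> (d x <= d y + 1)%N /\ (d y <= d x + 1)%N.
Local Notation H := (ell2 R (dipath G)).
Local Notation A_G := (@graph_norm_algebra R G).

Definition select (P : pred (dipath G)) q : option (dipath G) :=
  if P q then Some q else None.

Lemma select_inj P u v w : select P u = Some w -> select P v = Some w -> u = v.
Proof. by rewrite /select; case: ifP => // _ [->]; case: ifP => // _ [->]. Qed.

Definition potential_op : H -> H :=
  (reindex_op (@select_inj [pred p | d (psrc p) == (d (prng p)).+1])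
   : H -> H) -
  reindex_op (@select_inj [pred p | d (prng p) == (d (psrc p)).+1]).

Lemma bounded_potential_op : bounded_op potential_op.
Proof. by apply: bounded_opB; exact: bounded_reindex_op. Qed.

Lemma potential_opE g q :
  potential_op g q = ((d (psrc q))%:R - (d (prng q))%:R) * g q.
Proof.
rewrite -[LHS]/(oapp g 0 (select _ q) - oapp g 0 (select _ q)) /select /=.
have [h1 h2] := d_reach (walk_reach (dipath_walk q)).
have [sr|sr] := eqVneq (d (psrc q)) (d (prng q)).+1.
  rewrite sr (negPf (_ : d (prng q) != _)) /=; last by lia.
  by rewrite subr0 -natr1 addrAC subrr add0r mul1r.
have [rs|rs] := eqVneq (d (prng q)) (d (psrc q)).+1.
  by rewrite rs /= -natr1 opprD addrA subrr !sub0r mulN1r.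
have -> : d (psrc q) = d (prng q) by lia.
by rewrite !subrr mul0r.
Qed.

Lemma commutator_potential_edge f :
  commutator potential_op (Ledge f) = ((d (src f))%:R - (d (rng f))%:R) *: (Ledge f : H -> H).
Proof.
apply/funext => g; apply: ell2_ext => q.
rewrite /commutator -[LHS]/(potential_op (Ledge f g) q - Ledge f (potential_op g) q).
rewrite -[RHS]/(((d (src f))%:R - (d (rng f))%:R) * Ledge f g q).
rewrite potential_opE -[Ledge f g q]/(oapp g 0 (ecut f q)).
rewrite -[Ledge f (potential_op g) q]/(oapp (potential_op g) 0 (ecut f q)).
case E : (ecut f q) => [w|]; last by rewrite ![oapp _ _ _]/= !mulr0 subr0.
rewrite -[oapp g 0 _]/(g w) -[oapp (potential_op g) 0 _]/(potential_op g w).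
rewrite potential_opE -mulrBl.
move/ecutE: E => [h1 h2 h3]; congr (_ * _).
have -> : psrc q = psrc w by rewrite /psrc h1 h2 h3.
by rewrite /prng h1 h3; ring.
Qed.

Lemma commutator_potential_vertex x : commutator potential_op (Lvertex x) = 0.
Proof.
apply/funext => g; apply: ell2_ext => q.
rewrite /commutator -[LHS]/(potential_op (Lvertex x g) q - Lvertex x (potential_op g) q).
rewrite -[RHS]/(0 : R[i]) potential_opE -[Lvertex x g q]/(oapp g 0 (vcut x q)).
rewrite -[Lvertex x (potential_op g) q]/(oapp (potential_op g) 0 (vcut x q)).
rewrite /vcut; case: ifP => _; last by rewrite ![oapp _ _ _]/= mulr0 subr0.
rewrite -[oapp g 0 _]/(g q) -[oapp (potential_op g) 0 _]/(potential_op g q).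
by rewrite potential_opE subrr.
Qed.

(** A potential, possibly unbounded, that varies by at most one along directed
    paths has the same coboundary as a bounded function. *)
Lemma potential_coboundary : all_derivations_inner R G ->
  exists (a : vertex G -> R[i]) (K : R), (forall x, Normc.normc (a x) <= K) /\
    forall f, (d (src f))%:R - (d (rng f))%:R = a (src f) - a (rng f).
Proof.
move=> hder; have [bA A0 lA _] := graph_norm_algebra_subalgebra R G.
have [f|x|t [K [tK tE]]] := @implemented_coefficients R G potential_op hder bounded_potential_op.
- rewrite commutator_potential_edge -[_ *: _]addr0; apply: lA => //.
  by apply: sub_norm_closed_algebra; left; exists f.
- by rewrite commutator_potential_vertex.
exists (fun x => t x (vpath x)), K; split=> // f.
have := tE f (epath f); rewrite commutator_potential_edge.
rewrite -[X in X = _ -> _]/(((d (src f))%:R - (d (rng f))%:R) *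
  Ledge f (xi (vpath (src f))) (epath f)).
rewrite Ledge_xi_src /= eqxx mulr1 => ->.
rewrite (_ : ecut f _ = Some (vpath (src f))); last by apply/ecutE.
by rewrite (_ : rcut f _ = Some (vpath (rng f))); last by apply/rcutE.
Qed.

End Potential.

(** * Rigidity of the graph *)

Section Rigid.
Variable G : digraph.

(** [h] is one side of a cut of the vertices that [e] alone crosses; in
    particular, removing [e] disconnects its two ends. *)
Definition bridge (e : edge G) (h : pred (vertex G)) : Prop :=
  [/\ h (src e), ~~ h (rng e) & forall f, f != e -> h (src f) = h (rng f)].

Definition incident (f : edge G) (x : vertex G) : Prop := src f = x \/ rng f = x.

(** What the derivations obtained by inserting cycles around a non-cyclic edge
    reveal about the graph. The decomposition into a tree and circles follows from
    these three properties. *)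
Record rigid : Prop := Rigid {
  rigid_bridge : forall e, ~ cyclic e -> exists h, bridge e h;
  rigid_ends : forall (e : edge G) b c, ~ cyclic e ->
    walk (rng e) b (rng e) -> walk (src e) c (src e) -> b = [::] \/ c = [::];
  rigid_cycle : forall (e : edge G) x b y f, ~ cyclic e -> incident e x ->
    walk x b x -> b != [::] -> y \in map rng b -> incident f y ->
    f \in b \/ f = e }.

End Rigid.

Section InnerRigid.
Variables (R : realType) (G : digraph).
Hypothesis inner : all_derivations_inner R G.

(** With nothing inserted, the diagonal coefficients [t x x] have coboundary the
    indicator of [e]; a level set of them is the required side. *)
Lemma inner_bridge (e : edge G) : ~ cyclic e -> exists h, bridge e h.
Proof.
move=> ne; have wn (x : vertex G) : walk x [::] x by rewrite /walk /= eqxx.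
have [t tE] := insertion_coefficients ne (wn _) (wn _) inner.
pose a x := t x (vpath x).
have aE f : (f == e)%:R = a (src f) - a (rng f).
  have := tE f (epath f).
  rewrite (_ : ecut f _ = Some (vpath (src f))); last by apply/ecutE.
  rewrite (_ : rcut f _ = Some (vpath (rng f))); last by apply/rcutE.
  by rewrite /= => <-; rewrite eqseq_cons andbT andbb.
exists [pred x | a x == a (src e)]; split=> /=.
- exact: eqxx.
- apply/eqP => h; have := aE e; rewrite eqxx h subrr => /eqP.
  by rewrite oner_eq0.
- move=> f fe; have := aE f; rewrite (negPf fe) => /esym/eqP.
  by rewrite subr_eq0 => /eqP ->.
Qed.

(** With cycles inserted on both sides, both cuts of b e c vanish: it neither
    starts nor ends with [e], whereas the coefficient relation there reads 1 = 0. *)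
Lemma inner_ends (e : edge G) b c : ~ cyclic e ->
  walk (rng e) b (rng e) -> walk (src e) c (src e) -> b = [::] \/ c = [::].
Proof.
move=> ne wb wc; have [t tE] := insertion_coefficients ne wb wc inner.
have [->|b0] := eqVneq b [::]; first by left.
have [->|c0] := eqVneq c [::]; first by right.
have wv : walk (rng e) (b ++ e :: c) (src e).
  by apply: (walkI wb); rewrite walk_cons eqxx.
have vc := proj1 (andP wv).
have := tE e (@Dipath G (rng e, b ++ e :: c) vc); rewrite /= !eqxx /=.
case E : (ecut e _) => [m|].
  exfalso; move/ecutE: E => [_ /= + _]; case: (b) b0 wb => //= f l _ wb [fe _].
  by case: ne; apply: (closed_walk_cyclic wb); rewrite fe inE eqxx.
case E' : (rcut e _) => [m|].
  exfalso; move/rcutE: E' => [_ /=]; case/lastP: (c) c0 wc => //= l f _ wc.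
  rewrite -rcons_cons -rcons_cat => /rcons_inj[_ fe].
  by case: ne; apply: (closed_walk_cyclic wc); rewrite fe mem_rcons inE eqxx.
by rewrite /= subrr => /eqP; rewrite oner_eq0.
Qed.

Section Rotation.
(* [t] is thought of as the coefficients of an operator that commutes with all the
   generators except the one of [e]. *)
Variables (e : edge G) (t : vertex G -> dipath G -> R[i]).
Hypothesis tE : forall f v, f != e ->
  oapp (t (src f)) 0 (ecut f v) = oapp (t (rng f)) 0 (rcut f v).

(** Defaults to the path of length zero when [l] is not a chain from [x]. *)
Definition mkpath (x : vertex G) (l : seq (edge G)) : dipath G :=
  insubd (vpath x) (x, l).

Lemma mkpathE x l : chain x l -> val (mkpath x l) = (x, l).
Proof. by move=> xl; rewrite /mkpath insubdK. Qed.

Lemma ecut_mkpath f l : chain (src f) l ->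
  ecut f (mkpath (rng f) (f :: l)) = Some (mkpath (src f) l).
Proof. by move=> fl; apply/ecutE; rewrite !mkpathE//= eqxx. Qed.

Lemma rcut_mkpath x f l : walk x l (rng f) ->
  rcut f (mkpath x (rcons l f)) = Some (mkpath x l).
Proof.
move=> /andP[xl /eqP lf]; apply/rcutE; rewrite !mkpathE//.
by rewrite -cats1 chain_cat xl lf /= eqxx.
Qed.

(** Commuting with L_f makes the coefficient at the cycle f u equal to the one at
    the rotated cycle u f: apply the relation to the path f u f. *)
Lemma coefficient_rotation x y u w : walk x u y -> walk y w x ->
  e \notin u -> t x (mkpath x (u ++ w)) = t y (mkpath y (w ++ u)).
Proof.
elim: u x w => [|f u IH] x w.
  by rewrite /walk /= => /eqP -> _ _; rewrite cats0.
rewrite walk_cons => /andP[/eqP fx uy] wx; rewrite inE negb_or => /andP[ef eu].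
rewrite -cat_rcons -cats1.
have wf : walk y (w ++ [:: f]) (src f).
  by apply: walkI wx _; rewrite walk_cons fx !eqxx /walk /=.
rewrite -(IH _ _ uy wf eu).
have uw : walk (src f) (u ++ w) (rng f) by rewrite fx; exact: walkI uy wx.
have := @tE f (mkpath (rng f) (f :: rcons (u ++ w) f)).
rewrite eq_sym => /(_ ef).
rewrite ecut_mkpath; last first.
  by have /andP[h /eqP h'] := uw; rewrite -cats1 chain_cat h h' /= eqxx.
rewrite -rcons_cons rcut_mkpath; last by rewrite walk_cons eqxx.
by rewrite /= -fx cats1 rcons_cat => ->.
Qed.

(** Rotate the cycle so that it is based at [y]. If [f] enters [y] then b f
    has right cut b but no left cut, since b does not start with [f]; if [f] leaves
    [y] then f b has left cut b but no right cut. Either way commuting with L_f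
    makes the coefficient at b vanish. *)
Lemma coefficient_isolated x b y f : walk x b x -> e \notin b ->
  t x (mkpath x b) != 0 -> y \in map rng b -> incident f y ->
  f \in b \/ f = e.
Proof.
move=> xb eb t0 /mapP[g gb yE] fy.
have [->|fe] := eqVneq f e; first by right.
left; apply/negPn/negP => fb.
move: gb xb eb t0 fb => /path.splitPr h; case: h => u w.
rewrite walk_cat => /andP[xu zx].
have zy : last x (map src u) = y.
  by move: zx; rewrite walk_cons => /andP[/eqP <- _].
move: zx xu; rewrite zy {zy} => yx xy; rewrite !mem_cat !inE !negb_or.
move=> /and3P[eu _ _]; rewrite (coefficient_rotation xy yx eu) => t0 /and3P[fu fg fw].
have yy : walk y (g :: (w ++ u)) y by exact: walkI yx xy.
case: fy => [fy|fy].
  have := @tE f (mkpath (rng f) (f :: (g :: (w ++ u)))) fe.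
  rewrite ecut_mkpath; last by rewrite fy; case/andP: yy.
  case E : (rcut f _) => [m|].
    move/rcutE: E => [_]; rewrite mkpathE; last first.
      by rewrite /= eqxx fy; case/andP: yy.
    have := mem_last g (w ++ u).
    move=> lm /= /(congr1 (last f)); rewrite last_rcons /= => lf.
    move: lm; rewrite lf inE mem_cat => /or3P[/eqP fg'|fw'|fu'].
    - by rewrite fg' eqxx in fg.
    - by rewrite fw' in fw.
    - by rewrite fu' in fu.
  by move=> /= h; rewrite -fy h eqxx in t0.
have := @tE f (mkpath y (rcons (g :: (w ++ u)) f)) fe.
rewrite rcut_mkpath ?fy//.
case E : (ecut f _) => [m|].
  move/ecutE: E => [_ + _]; rewrite mkpathE.
    by move=> [gf _]; rewrite gf eqxx in fg.
  by have /andP[h /eqP h'] := yy; rewrite -cats1 chain_cat h h' /= fy eqxx.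
by move=> /= h; rewrite -h eqxx in t0.
Qed.

End Rotation.

(** Insert [b] on the side of [e] where it is attached. The relation at the path
    e b, or b e, says that the coefficient at [b] is 1, or -1, so that
    [coefficient_isolated] applies. *)
Lemma inner_cycle (e : edge G) x b y f : ~ cyclic e -> incident e x ->
  walk x b x -> b != [::] -> y \in map rng b -> incident f y ->
  f \in b \/ f = e.
Proof.
move=> ne ex xb b0; have eb : e \notin b.
  by apply/negP => /(closed_walk_cyclic xb).
have wn (z : vertex G) : walk z [::] z by rewrite /walk /= eqxx.
case: ex => ex.
- have wb : walk (src e) b (src e) by rewrite ex.
  have [t tE] := insertion_coefficients ne (wn _) wb inner.
  apply: (@coefficient_isolated e t _ x b y) => //.
    by move=> g v ge; apply/eqP; rewrite -subr_eq0 -tE (negPf ge).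
  have bc : chain (src e) b by case/andP: wb.
  have := tE e (mkpath (rng e) (e :: b)); rewrite ecut_mkpath//.
  rewrite mkpathE /= ?eqxx//.
  case E : (rcut e _) => [m|]; last first.
    by rewrite /= subr0 -ex => <-; rewrite oner_eq0.
  exfalso; move/rcutE: E => [_]; rewrite mkpathE /= ?eqxx//.
  case/lastP: b b0 eb {xb wb tE bc} => // l g _; rewrite mem_rcons inE negb_or.
  by move=> /andP[/eqP eg _]; rewrite -rcons_cons => /rcons_inj[_ /esym].
- have wb : walk (rng e) b (rng e) by rewrite ex.
  have [t tE] := insertion_coefficients ne wb (wn _) inner.
  apply: (@coefficient_isolated e t _ x b y) => //.
    by move=> g v ge; apply/eqP; rewrite -subr_eq0 -tE (negPf ge).
  have vc : chain x (rcons b e).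
    by have /andP[h /eqP h'] := xb; rewrite -cats1 chain_cat h h' /= ex eqxx.
  have := tE e (mkpath x (rcons b e)); rewrite rcut_mkpath ?ex//.
  rewrite mkpathE//= cats1 !eqxx.
  case E : (ecut e _) => [m|]; last first.
    rewrite /= sub0r => h; apply/eqP => h'.
    by move: h; rewrite h' oppr0 => /eqP; rewrite oner_eq0.
  exfalso; move/ecutE: E => [_ + _]; rewrite mkpathE//=.
  case: b b0 eb {xb wb tE vc} => // g l _; rewrite inE negb_or.
  by move=> /andP[/eqP eg _] [/esym].
Qed.

Lemma inner_rigid : rigid G.
Proof.
split; [exact: inner_bridge | exact: inner_ends | exact: inner_cycle].
Qed.

End InnerRigid.

(** * Zigzag distance *)

Section Zigzag.
Variable G : digraph.
Implicit Types x y z : vertex G.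

Fixpoint zigzag m x y : Prop :=
  if m is m'.+1 then exists2 z, zigzag m' x z & reach z y \/ reach y z else x = y.

Lemma zigzag_trans m k x y z : zigzag m x y -> zigzag k y z -> zigzag (m + k) x z.
Proof.
elim: k z => [|k IH] z xy /=; first by move=> <-; rewrite addn0.
by move=> [w yw wz]; rewrite addnS; exists w => //; exact: IH.
Qed.

Lemma zigzag_sym m x y : zigzag m x y -> zigzag m y x.
Proof.
elim: m y => //= m IH y [z xz zy].
apply: (@zigzag_trans 1 m) (IH _ xz).
by exists y => //; case: zy; [right | left].
Qed.

Lemma uconnect_zigzag x y : uconnect x y -> exists m, zigzag m x y.
Proof.
elim=> [{}x {}y xy|{}x|{}x {}y _ [m xy]|{}x {}y z _ [m xy] _ [k yz]].
- by exists 1, x => //; left; exact: rt_step.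
- by exists 0.
- by exists m; exact: zigzag_sym.
- by exists (m + k)%N; exact: zigzag_trans yz.
Qed.

Lemma reach_uconnect x y : reach x y -> uconnect x y.
Proof.
elim=> [{}x {}y xy|{}x|{}x {}y z _ xy _ yz]; [exact: rst_step | exact: rst_refl |].
exact: rst_trans yz.
Qed.

Lemma component_of_eq x y : uconnect x y -> component_of x = component_of y.
Proof.
move=> xy; apply/seteqP; split=> z /=; apply: rst_trans => //; exact: rst_sym.
Qed.

(** The choice depends on the component as a set only, so that all its vertices
    share one root. *)
Definition root x : vertex G := xget x (component_of x).

Lemma root_uconnect x : uconnect (root x) x.
Proof.
apply: rst_sym; apply: (@xgetPex _ x (component_of x)).
by exists x; exact: rst_refl.
Qed.

Lemma root_eq x y : uconnect x y -> root x = root y.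
Proof.
move=> xy; rewrite /root (component_of_eq xy).
have h : component_of y y by exact: rst_refl.
by rewrite /xget; case: pselect => [//|[]]; exists y; exact/asboolP.
Qed.

Lemma zigzag_root x : exists m, `[< zigzag m (root x) x >].
Proof. by have [m mx] := uconnect_zigzag (root_uconnect x); exists m; apply/asboolP. Qed.

Definition zdist x : nat := ex_minn (zigzag_root x).

Lemma zigzag_zdist x : zigzag (zdist x) (root x) x.
Proof. by rewrite /zdist; case: ex_minnP => m /asboolP. Qed.

Lemma zdist_min m x : zigzag m (root x) x -> (zdist x <= m)%N.
Proof. by rewrite /zdist; case: ex_minnP => k _ km /asboolP; exact: km. Qed.

(** One more directed path leads from one end of a directed path to the other. *)
Lemma zdist_reach x y : reach x y ->
  (zdist x <= zdist y + 1)%N /\ (zdist y <= zdist x + 1)%N.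
Proof.
move=> xy; have xyr := root_eq (reach_uconnect xy).
split; apply: zdist_min; rewrite addn1.
  by exists y; [rewrite xyr; exact: zigzag_zdist | right].
by exists x; [rewrite -xyr; exact: zigzag_zdist | left].
Qed.

Lemma zdist_root x : zdist (root x) = 0%N.
Proof.
apply/eqP; rewrite -leqn0; apply: zdist_min => /=.
exact: root_eq (root_uconnect x).
Qed.

(** The distance to the root is a potential to which [potential_coboundary]
    applies. A bounded function with the same coboundary differs from it by a
    constant on each component, and the distance vanishes at the root; so the
    distance is bounded by one constant for all components. *)
Lemma inner_zigzag_bounded (R : realType) : all_derivations_inner R G ->
  exists M, forall x y, uconnect x y -> exists2 m, (m <= M)%N & zigzag m x y.
Proof.
move=> inner.
have [a [K [aK aE]]] := potential_coboundary zdist_reach inner.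
have cst x y : uconnect x y -> a x - (zdist x)%:R = a y - (zdist y)%:R.
  elim=> [{}x {}y [f [<- <-]]|//|{}x {}y _ ->//|{}x {}y z _ -> _ ->//].
  apply/eqP; rewrite -subr_eq0; apply/eqP; rewrite opprB addrACA.
  have -> : a (src f) = (zdist (src f))%:R - (zdist (rng f))%:R + a (rng f).
    by rewrite aE subrK.
  ring.
have dK x : ((zdist x)%:R : R) <= 2 * K.
  have := cst _ _ (root_uconnect x); rewrite zdist_root subr0 => h.
  have {h} : ((zdist x)%:R : R[i]) = a x + - a (root x).
    by rewrite h; ring.
  move=> h; have : Normc.normc ((zdist x)%:R : R[i]) <= K + K.
    rewrite h; apply: le_trans (le_normcD _ _) _.
    by rewrite normcN; apply: lerD.
  rewrite (_ : Normc.normc _ = (zdist x)%:R); first by move=> /le_trans; apply; lra.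
  elim: (zdist x) => [|k _]; first by rewrite Normc.normc0.
  rewrite (_ : (k.+1%:R : R[i]) = ((k.+1%:R)%:C)%C); last by rewrite rmorph_nat.
  by rewrite /= expr0n addr0 sqrtr_sqr ger0_norm.
exists (Num.truncn (2 * K) + Num.truncn (2 * K))%N => x y xy.
exists (zdist x + zdist y)%N.
  by apply: leq_add; rewrite truncn_ge_nat// (le_trans _ (dK x))//.
apply: zigzag_trans (zigzag_sym (zigzag_zdist x)) _.
by rewrite (root_eq xy); exact: zigzag_zdist.
Qed.

End Zigzag.

(** * Restriction to a connected component *)

Section Component.
Variables (G : digraph) (C : set (vertex G)).
Hypothesis compC : components G C.
Local Notation K := (induced C).

Lemma component_uconnect x y : x \in C -> uconnect x y -> y \in C.
Proof.
have [z _ <-] := compC; rewrite !inE => zx xy; exact: rst_trans zx xy.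
Qed.

Lemma component_mutual x y : x \in C -> y \in C -> uconnect x y.
Proof.
have [z _ <-] := compC; rewrite !inE => zx zy.
by apply: rst_trans zy; exact: rst_sym.
Qed.

(** A directed path that starts in a component stays in it. *)
Lemma component_reach (x y : vertex K) : reach (val x) (val y) -> reach x y.
Proof.
case: x y => [x xC] [y yC] /= xy; elim: xy xC yC => {x y}.
- move=> x y [e [ex ey]] xC yC.
  have eC : (src e \in C) && (rng e \in C) by rewrite ex ey xC.
  apply: rt_step; exists (exist _ e eC).
  by split; apply/val_inj.
- by move=> x xC xC'; rewrite (bool_irrelevance xC xC'); exact: reach_refl.
- move=> x y z xy IH yz IH' xC zC.
  have yC : y \in C by exact: component_uconnect xC (reach_uconnect xy).
  exact: reach_trans (IH xC yC) (IH' yC zC).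
Qed.

Lemma induced_component_connected : Defs.connected K.
Proof.
move=> x y; have xy : uconnect (val x) (val y).
  exact: component_mutual (valP x) (valP y).
case: x y xy => [x xC] [y yC] /= xy; elim: xy xC yC => {x y}.
- move=> x y [e [ex ey]] xC yC.
  have eC : (src e \in C) && (rng e \in C) by rewrite ex ey xC.
  apply: rst_step; exists (exist _ e eC).
  by split; apply/val_inj.
- by move=> x xC xC'; rewrite (bool_irrelevance xC xC'); exact: rst_refl.
- by move=> x y _ IH yC xC; apply: rst_sym; exact: IH.
- move=> x y z xy IH yz IH' xC zC.
  have yC : y \in C by exact: component_uconnect xC xy.
  exact: rst_trans (IH xC yC) (IH' yC zC).
Qed.

Lemma component_cyclic (e : edge K) : cyclic (val e) -> cyclic e.
Proof. exact: (@component_reach (rng e) (src e)). Qed.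

Lemma component_walk (x y : vertex K) b :
  walk x b y -> walk (val x) (map val b) (val y).
Proof.
elim: b x => [|f b IH] x; first by rewrite /walk /= => /eqP ->.
by rewrite walk_cons => /andP[/eqP <- /IH]; rewrite /= walk_cons eqxx.
Qed.

Lemma component_incident (f : edge K) (x : vertex K) :
  incident f x -> incident (val f) (val x).
Proof. by case=> <-; [left | right]. Qed.

Lemma component_rigid : rigid G -> rigid K.
Proof.
move=> rG; split.
- move=> e /(contra_not (@component_cyclic e))/(rigid_bridge rG)[h [h1 h2 h3]].
  exists (fun x => h (val x)); split=> // f fe; apply: h3.
  by apply: contra_neq fe => /val_inj.
- move=> e b c /(contra_not (@component_cyclic e)) ne /component_walk wb /component_walk wc.
  by have [|] := rigid_ends rG ne wb wc; [case: (b); left | case: (c); right].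
- move=> e x b y f /(contra_not (@component_cyclic e)) ne /component_incident ex.
  move=> /component_walk wb b0 yb /component_incident fy.
  have [||fb|/val_inj] := rigid_cycle rG ne ex wb _ _ fy.
  + by case: (b) b0.
  + by rewrite -map_comp; move/mapP: yb => [g gb ->]; apply/mapP; exists g.
  + by left; move: fb; rewrite mem_map//; exact: val_inj.
  + by right.
Qed.

Lemma component_zigzag m (x y : vertex K) :
  zigzag m (val x) (val y) -> zigzag m x y.
Proof.
elim: m y => [|m IH] y /=; first by move/val_inj.
move=> [z xz zy]; have zC : z \in C.
  apply: component_uconnect (valP y) _.
  by case: zy => /reach_uconnect //; exact: rst_sym.
exists (exist _ z zC); first exact: IH.
by case: zy => zy; [left | right]; exact: component_reach.
Qed.

End Component.

(** * Cycles of a rigid graph *)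

Lemma pair_set_eq (T : Type) (a b c d : T) :
  [set a; b] = [set c; d] -> a = c /\ b = d \/ a = d /\ b = c.
Proof.
move=> E.
have Sa : [set c; d] a by rewrite -E; left.
have Sb : [set c; d] b by rewrite -E; right.
have Sc : [set a; b] c by rewrite E; left.
have Sd : [set a; b] d by rewrite E; right.
case: Sa => /= ad; case: Sb => /= bd; subst; [|by left|by right|].
  by case: Sd => /= <-; left.
by case: Sc => /= <-; left.
Qed.

Lemma uniq_map_inj (T T' : eqType) (g : T -> T') (s : seq T) (x y : T) :
  uniq (map g s) -> x \in s -> y \in s -> g x = g y -> x = y.
Proof.
elim: s => //= z s IH /andP[zs us]; rewrite !inE.
move=> /predU1P[->|xs] /predU1P[->|ys] //; last exact: IH.
  by move=> zy; case/negP: zs; rewrite zy map_f.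
by move=> xz; case/negP: zs; rewrite -xz map_f.
Qed.

Section Cycles.
Variable G : digraph.
Implicit Types (x y z : vertex G) (e f : edge G) (b : seq (edge G)).

(** Consecutive edges share a vertex: along a closed walk, the sources are the
    ranges shifted by one place. *)
Lemma walk_rng_src x b y : walk x b y -> x :: map src b = rcons (map rng b) y.
Proof.
elim: b x => [|f b IH] x; first by rewrite /walk /= => /eqP ->.
by rewrite walk_cons /= => /andP[/eqP -> /IH ->].
Qed.

Lemma walk_split f0 x b y i : (i < size b)%N -> walk x b y ->
  walk x (take i b) (rng (nth f0 b i)) && walk (rng (nth f0 b i)) (drop i b) y.
Proof.
move=> ib; rewrite -{1}(cat_take_drop i b) walk_cat (drop_nth f0 ib).
by rewrite !walk_cons => /andP[xw /andP[/eqP -> yw]]; rewrite xw eqxx.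
Qed.

(** Cut out the part of the walk between two visits of the same vertex. *)
Lemma simple_cycle x b : walk x b x -> b != [::] ->
  exists c, [/\ walk x c x, c != [::] & uniq (map rng c)].
Proof.
elim: {b}(size b).+1 {-2}b (ltnSn (size b)) => // n IH b bn xb b0.
have [ub|] := boolP (uniq (map rng b)); first by exists b.
case: b b0 bn xb => // f0 b _; set c := f0 :: b => bn xb.
move=> /(uniqPn x)[i [j [ij]]]; rewrite size_map => jc.
have ic := ltn_trans ij jc.
rewrite !(nth_map f0)// => rij.
have /andP[xi _] := walk_split f0 ic xb; have /andP[_ jx] := walk_split f0 jc xb.
apply: (IH (take i c ++ drop j c)).
- rewrite size_cat size_drop size_takel; last exact: ltnW.
  by lia.
- by apply: walkI jx; rewrite -rij.
- by rewrite -size_eq0 size_cat size_drop -lt0n addn_gt0 subn_gt0 jc orbT.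
Qed.

Lemma walk_src_mem x b f : walk x b x -> f \in b -> src f \in map rng b.
Proof.
move=> xb fb; have := walk_rng_src xb.
case: b fb xb => // g b fb xb [E1 E2].
have : src f \in map src (g :: b) by rewrite map_f.
rewrite [map src _]/= E2 /= mem_rcons.
by have /andP[/andP[/eqP -> _] _] := xb.
Qed.

Lemma walk_uniq_src x b : walk x b x -> uniq (map rng b) -> uniq (map src b).
Proof.
move=> xb; have := walk_rng_src xb; case: b xb => // g b xb.
rewrite [map src _]/= [map rng _]/= => -[E ->].
by rewrite rcons_uniq /= E.
Qed.

Lemma walk_last_rng f0 x b j : walk x b x -> (j < size b)%N ->
  src (nth f0 b j) = rng (nth f0 b (j.+1 %% size b)).
Proof.
move=> xb jb.
rewrite -(nth_map f0 x src jb) -[LHS]/(nth x (x :: map src b) j.+1).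
rewrite (walk_rng_src xb) nth_rcons size_map.
have [E|ne] := eqVneq j.+1 (size b).
  rewrite E ltnn modnn; case: b jb xb {E} => // g b _.
  by rewrite walk_cons => /andP[/eqP].
have jb' : (j.+1 < size b)%N by lia.
by rewrite jb' modn_small// (nth_map f0).
Qed.

End Cycles.

Section Structure.
Variable G : digraph.
(* In a rigid connected graph that is not strongly connected, every strongly
   connected class contains exactly one vertex of the trunk, and a class with an
   edge in it is a circle attached to the rest at that vertex. *)
Hypotheses (rG : rigid G) (cG : Defs.connected G) (nsG : ~ strongly_connected G).
Implicit Types (x y z l : vertex G) (e f : edge G) (b : seq (edge G)).

(** [x] and [y] lie in the same strongly connected class. *)
Definition mutual x y : Prop := reach x y /\ reach y x.

Lemma mutual_refl x : mutual x x.
Proof. by split; exact: reach_refl. Qed.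

Lemma mutual_sym x y : mutual x y -> mutual y x.
Proof. by case. Qed.

Lemma mutual_trans y x z : mutual x y -> mutual y z -> mutual x z.
Proof. by move=> [? ?] [? ?]; split; apply: (@reach_trans _ y). Qed.

Lemma cyclic_mutual f : cyclic f -> mutual (src f) (rng f).
Proof. by split=> //; exact: reach_edge. Qed.

Definition trunk x : Prop := exists2 e, ~ cyclic e & incident e x.

Lemma noncyclic_exists : exists e : edge G, ~ cyclic e.
Proof.
apply: contrapT => /forallNP allc; apply: nsG => x y.
have : mutual x y.
  elim: (cG x y) => {x y}.
  - by move=> _ _ [f [<- <-]]; apply: cyclic_mutual; exact: contrapT (allc f).
  - exact: mutual_refl.
  - by move=> x y _ /mutual_sym.
  - by move=> x y z _ + _; exact: mutual_trans.
move=> [/reach_walk[b /andP[yb /eqP bx]] _].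
by exists (@Dipath G (y, b) yb).
Qed.

(** Whether the class of a vertex meets the trunk does not change along an edge:
    a cyclic edge stays in one class, and both ends of a non-cyclic edge are in the
    trunk. So it holds everywhere in a connected graph with a non-cyclic edge. *)
Lemma trunk_exists x : exists2 l, trunk l & mutual l x.
Proof.
have [e0 ne0] := noncyclic_exists.
have h : forall x y, uconnect x y ->
  (exists2 l, trunk l & mutual l x) <-> (exists2 l, trunk l & mutual l y).
  move=> {}x y; elim=> {x y}.
  - move=> _ _ [f [<- <-]]; have [cf|ncf] := pselect (cyclic f).
      have cf' := cyclic_mutual cf.
      split=> -[l tl lf]; exists l => //; first exact: mutual_trans lf cf'.
      exact: mutual_trans lf (mutual_sym cf').
    split=> _; [exists (rng f)|exists (src f)]; try exact: mutual_refl.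
      by exists f => //; right.
    by exists f => //; left.
  - by [].
  - by move=> x y _ ->.
  - by move=> x y z _ -> _ ->.
apply/(h _ _ (cG (src e0) x)); exists (src e0); last exact: mutual_refl.
by exists e0 => //; left.
Qed.

Section Circle.
Variables (l : vertex G) (e : edge G) (b : seq (edge G)).
Hypotheses (ne : ~ cyclic e) (el : incident e l).
Hypotheses (lb : walk l b l) (b0 : b != [::]).

Lemma circle_incident y f : y \in map rng b -> cyclic f -> incident f y -> f \in b.
Proof.
move=> yb cf fy; have [//|fe] := rigid_cycle rG ne el lb b0 yb fy.
by rewrite fe in cf.
Qed.

Lemma circle_root : l \in map rng b.
Proof.
case: b lb b0 => // f b'; rewrite walk_cons => /andP[/eqP <- _] _.
by rewrite inE eqxx.
Qed.

(** The vertices of [b] are closed under cyclic edges by rigidity, and a path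
    between two vertices of a class uses cyclic edges only. *)
Lemma circle_mutual y : mutual l y -> y \in map rng b.
Proof.
move=> [/reach_walk[w]]; elim: w y => [|f w IH] y.
  by rewrite /walk /= => /eqP -> _; exact: circle_root.
rewrite walk_cons => /andP[/eqP fy fw] yl.
have fl : reach (src f) l by apply: reach_trans yl; rewrite -fy; exact: reach_edge.
have cf : cyclic f.
  by rewrite /cyclic fy; apply: reach_trans yl _; exact: walk_reach fw.
have fb : f \in b by apply: (circle_incident (IH _ fw fl) cf); left.
by rewrite -fy map_f.
Qed.

Lemma circle_rng_mutual y : y \in map rng b -> mutual l y.
Proof.
move=> /mapP[f fb ->]; have [h1 h2] := walk_mem lb fb.
by split=> //; apply: reach_trans h1 (reach_edge f).
Qed.

End Circle.

Definition on_cycle x : Prop := exists2 b, b != [::] & walk x b x.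

Lemma on_cycle_mutual x y : mutual x y -> x <> y -> on_cycle x.
Proof.
move=> [/reach_walk[b yx] /reach_walk[b' xy]] ne; exists (b' ++ b).
  case: b' xy => //= /eqP; case: b yx => //=; by move=> _ /esym /ne.
exact: walkI xy yx.
Qed.

Lemma cyclic_on_cycle f x : cyclic f -> mutual x (rng f) -> on_cycle x.
Proof.
move=> /reach_walk[b fb] [/reach_walk[w fx] /reach_walk[w' xf]].
exists (w' ++ (f :: b) ++ w); first by case: w' {xf}.
apply: walkI xf _; apply: walkI fx.
by rewrite walk_cons eqxx.
Qed.

(** Otherwise a cycle through [l] also passes through [l'], and rigidity makes
    the non-cyclic edges at [l] and at [l'] coincide; but the ends of a non-cyclic
    edge are not in the same class. *)
Lemma trunk_mutual l l' : trunk l -> trunk l' -> mutual l l' -> l = l'.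
Proof.
move=> [e ne el] [e' ne' el'] ll'; apply: contrapT => nll'.
have [b b0 lb] := on_cycle_mutual ll' nll'.
have l'b := circle_mutual ne el lb b0 ll'.
have [/(closed_walk_cyclic lb)//|ee'] := rigid_cycle rG ne el lb b0 l'b el'.
apply: ne; rewrite ee' in el'; have [h1 h2] := ll'.
by case: el el' => E [] E'; rewrite /cyclic ?E ?E'//; case: nll'; rewrite -E -E'.
Qed.

Lemma cyclic_circle f : cyclic f -> exists b e,
  [/\ [/\ ~ cyclic e, f \in b & uniq (map rng b)], uniq (map src b),
    forall g, g \in b -> cyclic g /\ forall y, incident g y -> y \in map rng b
  & forall y g, y \in map rng b -> incident g y -> g \in b \/ g = e].
Proof.
move=> cf; have [l [e ne el] lf] := trunk_exists (rng f).
have [b' b'0 lb'] := cyclic_on_cycle cf lf.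
have [b [lb b0 ub]] := simple_cycle lb' b'0.
exists b, e; split; [split=> //| exact: walk_uniq_src lb ub | |].
- apply: (circle_incident ne el lb b0 (circle_mutual ne el lb b0 lf) cf).
  by right.
- move=> g gb; split; first exact: closed_walk_cyclic lb gb.
  by move=> y [<-|<-]; [exact: walk_src_mem lb gb | exact: map_f].
- by move=> y g yb gy; exact: (rigid_cycle rG ne el lb b0 yb gy).
Qed.

(** In a circle, each vertex is the source of one edge and the range of one. *)
Lemma cyclic_inj f f' : cyclic f -> cyclic f' ->
  src f = src f' \/ rng f = rng f' -> f = f'.
Proof.
move=> cf cf' ff'; have [b [e [[ne fb ur] us bi be]]] := cyclic_circle cf.
have [_ fi] := bi _ fb.
have f'b : f' \in b.
  case: ff' => E.
    have [|f'e] // := be (src f) f' (fi _ (or_introl erefl)) (or_introl (esym E)).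
    by rewrite f'e in cf'.
  have [|f'e] // := be (rng f) f' (fi _ (or_intror erefl)) (or_intror (esym E)).
  by rewrite f'e in cf'.
by case: ff'; [exact: uniq_map_inj us fb f'b | exact: uniq_map_inj ur fb f'b].
Qed.

End Structure.

(** * Decomposition into a tree and its fruits *)

Section FruitTreeStructure.
Variable G : digraph.
Hypotheses (rG : rigid G) (cG : Defs.connected G) (nsG : ~ strongly_connected G).

Definition tree_edge := {e : edge G | `[< ~ cyclic e >]}.
Definition tree_vertex := {x : vertex G | `[< trunk x >]}.

Lemma tree_edgeP (e : tree_edge) : ~ cyclic (val e).
Proof. by case: e => e /= /asboolP. Qed.
Arguments tree_edgeP : clear implicits.

Lemma tree_vertexP (x : tree_vertex) : trunk (val x).
Proof. by case: x => x /= /asboolP. Qed.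

Lemma tree_src_subproof (e : tree_edge) : `[< trunk (src (val e)) >].
Proof. by apply/asboolP; exists (val e); [exact: tree_edgeP | left]. Qed.

Lemma tree_rng_subproof (e : tree_edge) : `[< trunk (rng (val e)) >].
Proof. by apply/asboolP; exists (val e); [exact: tree_edgeP | right]. Qed.

(** The non-cyclic edges, with all their ends as vertices. *)
Definition tree : digraph :=
  @Digraph tree_vertex tree_edge
    (fun e => exist _ (src (val e)) (tree_src_subproof e))
    (fun e => exist _ (rng (val e)) (tree_rng_subproof e)).

Definition grafting : set (vertex tree) := [set l | on_cycle (val l)].

(** Send every vertex to the trunk vertex of its class: a cyclic edge is then
    contracted, and a non-cyclic edge is kept. *)
Lemma tree_connected : Defs.connected tree.
Proof.
have h : forall x y, uconnect x y -> forall x' y' : vertex tree,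
    mutual (val x') x -> mutual (val y') y -> uconnect x' y'.
  have eq_step (x : vertex G) (x' y' : vertex tree) :
      mutual (val x') x -> mutual (val y') x -> x' = y'.
    move=> x'x y'x; apply/val_inj; apply: (trunk_mutual rG); try exact: tree_vertexP.
    exact: mutual_trans x'x (mutual_sym y'x).
  move=> x y; elim=> {x y}.
  - move=> _ _ [f [<- <-]] x' y' x's y'r; have [cf|ncf] := pselect (cyclic f).
      rewrite (eq_step _ _ _ x's (mutual_trans y'r (mutual_sym (cyclic_mutual cf)))).
      exact: rst_refl.
    have fE : `[< ~ cyclic f >] by apply/asboolP.
    pose f' : edge tree := exist _ f fE.
    have -> : x' = src f' by apply: (eq_step (src f)) => //; exact: mutual_refl.
    have -> : y' = rng f' by apply: (eq_step (rng f)) => //; exact: mutual_refl.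
    by apply: rst_step; exists f'.
  - by move=> x x' y' x'x y'x; rewrite (eq_step _ _ _ x'x y'x); exact: rst_refl.
  - by move=> x y _ IH x' y' x'y y'x; apply: rst_sym; exact: IH.
  - move=> x y z _ IH _ IH' x' z' x'x z'z.
    have [l tl ly] := trunk_exists cG nsG y.
    have lE : `[< trunk l >] by apply/asboolP.
    by apply: (@rst_trans _ _ _ (exist _ l lE : vertex tree)); [exact: IH | exact: IH'].
by move=> x y; apply: (h _ _ (cG (val x) (val y))); exact: mutual_refl.
Qed.

(** Going around the polygon along the other edges leads from one end of the
    first edge to the other without leaving its side of the cut. *)
Lemma tree_no_polygon n (v : 'I_n -> vertex tree) (e : 'I_n -> edge tree) :
  (0 < n)%N -> ~ polygon v e.
Proof.
move=> n0 [vinj einj vE]; pose j0 := Ordinal n0.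
have [h [h1 h2 h3]] := rigid_bridge rG (tree_edgeP (e j0)).
have step j : j != j0 -> h (val (v j)) = h (val (v (ordS j))).
  move=> jj0; have := h3 (val (e j)).
  have -> : val (e j) != val (e j0).
    by apply: contra_neq jj0 => /val_inj/einj.
  move=> /(_ isT).
  by case: (pair_set_eq (vE j)) => -[] /(congr1 val) /= -> /(congr1 val) /= ->.
have around k (kn : (k.+1 %% n < n)%N) : (k < n)%N ->
    h (val (v (Ordinal kn))) = h (val (v (ordS j0))).
  elim: k kn => [|k IH] kn k1n.
    by rewrite (_ : Ordinal kn = ordS j0)//; apply: ord_inj.
  have kn' : (k.+1 %% n < n)%N by rewrite ltn_pmod.
  rewrite -(IH kn' (ltnW k1n)) [RHS]step; last first.
    by rewrite -val_eqE /= modn_small.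
  by congr (h (val (v _))); apply: ord_inj; rewrite /= (modn_small k1n).
have kn : (n.-1.+1 %% n < n)%N by rewrite ltn_pmod.
have : h (val (v j0)) = h (val (v (ordS j0))).
  rewrite -(around n.-1 kn); last by rewrite prednK.
  by congr (h (val (v _))); apply: ord_inj; rewrite /= prednK// modnn.
case: (pair_set_eq (vE j0)) => -[] /(congr1 val) /= E1 /(congr1 val) /= E2;
  rewrite -E1 -E2 => h0; by move: h1 h2; rewrite /= h0 => ->.
Qed.

Lemma tree_generalized_tree : generalized_tree tree.
Proof.
split; [exact: tree_connected | | exact: tree_no_polygon].
have [e0 ne0] := noncyclic_exists cG nsG.
have eE : `[< ~ cyclic e0 >] by apply/asboolP.
pose e : edge tree := exist _ e0 eE.
exists (src e), (rng e) => /(congr1 val) /= E.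
by apply: ne0; rewrite /cyclic E; exact: reach_refl.
Qed.

(** Rigidity leaves a single non-cyclic edge at a vertex on a cycle. *)
Lemma grafting_leaf : grafting `<=` leaf tree.
Proof.
move=> l [b b0 lb]; have [e0 ne0 el] := tree_vertexP l.
have eE : `[< ~ cyclic e0 >] by apply/asboolP.
pose e : edge tree := exist _ e0 eE.
exists e; apply/seteqP; split=> f /=; last first.
  by move=> ->; case: el => el; [left | right]; apply/val_inj.
move=> fl; apply/val_inj.
have fl' : incident (val f) (val l) by case: fl => <-; [left | right].
have [/(closed_walk_cyclic lb)/(tree_edgeP f)//|//] :=
  rigid_cycle rG ne0 el lb b0 (circle_root lb b0) fl'.
Qed.

(** If every trunk vertex were on a cycle, a non-cyclic edge would join two
    cycles. *)
Lemma grafting_proper : grafting <> setT.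
Proof.
move=> gT; have [e0 ne0] := noncyclic_exists cG nsG.
have eE : `[< ~ cyclic e0 >] by apply/asboolP.
pose e : edge tree := exist _ e0 eE.
have : grafting (src e) by rewrite gT.
have : grafting (rng e) by rewrite gT.
move=> [b b0 rb] [c c0 sc].
by case: (rigid_ends rG ne0 rb sc) => E; rewrite E in b0 c0.
Qed.

Lemma fruit_exists (l : grafting) : exists b : seq (edge G),
  [/\ walk (val (val l)) b (val (val l)), b != [::] & uniq (map rng b)].
Proof.
by have [b b0 lb] := set_valP l; exact: simple_cycle lb b0.
Qed.

Definition fruit (l : grafting) : seq (edge G) := projT1 (cid (fruit_exists l)).

Lemma fruitP l :
  [/\ walk (val (val l)) (fruit l) (val (val l)), fruit l != [::] & uniq (map rng (fruit l))].
Proof. by rewrite /fruit; case: cid. Qed.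

Lemma fruit_size_gt0 l : (0 < size (fruit l))%N.
Proof. by have [_ + _] := fruitP l; case: (fruit l). Qed.

Definition stem (l : grafting) : vertex (circle (size (fruit l))) :=
  Ordinal (fruit_size_gt0 l).

Local Notation fedge l j := (tnth (in_tuple (fruit l)) j).

Definition vertex_map (x : vertex tree + vertex (fruits (fun l => size (fruit l)))) : vertex G :=
  match x with
  | inl x => val x
  | inr y => rng (fedge (tag y) (tagged y))
  end.

Definition edge_map (x : edge tree + edge (fruits (fun l => size (fruit l)))) : edge G :=
  match x with
  | inl e => val e
  | inr y => fedge (tag y) (tagged y)
  end.

Lemma rng_stem l : rng (fedge l (stem l)) = val (val l).
Proof.
have f : edge G := fedge l (stem l); rewrite (tnth_nth f) /=.
have [+ _ _] := fruitP l; have := fruit_size_gt0 l.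
by case: (fruit l) => // g b _; rewrite walk_cons => /andP[/eqP].
Qed.

Lemma src_fedge l (j : 'I_(size (fruit l))) : src (fedge l j) = rng (fedge l (ordS j)).
Proof.
have [lb _ _] := fruitP l; have f : edge G := fedge l j.
by rewrite !(tnth_nth f) /= (walk_last_rng f lb (ltn_ord j)).
Qed.

Lemma fedge_inj l (i j : 'I_(size (fruit l))) : rng (fedge l i) = rng (fedge l j) -> i = j.
Proof.
have [_ _ ub] := fruitP l; have f : edge G := fedge l i.
have ni := ltn_ord i; have nj := ltn_ord j.
rewrite !(tnth_nth f) /= => E; apply: ord_inj; apply/eqP.
rewrite -(nth_uniq (val (val l)) _ _ ub) ?size_map//.
by rewrite !(nth_map f)//; apply/eqP.
Qed.

Lemma fedge_mutual l (j : 'I_(size (fruit l))) : mutual (val (val l)) (rng (fedge l j)).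
Proof.
have [lb b0 _] := fruitP l.
by apply: (circle_rng_mutual lb); apply: map_f; exact: mem_tnth.
Qed.

Lemma fedge_eq_base (l l' : grafting) i j :
  rng (fedge l i) = rng (fedge l' j) -> l = l'.
Proof.
move=> E; apply/val_inj/val_inj.
apply: (trunk_mutual rG); try exact: tree_vertexP.
by apply: mutual_trans (fedge_mutual i) _; rewrite E; exact: mutual_sym (fedge_mutual j).
Qed.

Lemma vertex_map_attach x : vertex_map (attach stem x) = vertex_map x.
Proof. by case: x => [//|[l j]] /=; case: eqP => //= ->; rewrite rng_stem. Qed.

Lemma vertex_map_inj x y : vertex_map x = vertex_map y -> attach stem x = attach stem y.
Proof.
have mixed (a : vertex tree) (l : grafting) (j : 'I_(size (fruit l))) :
    val a = rng (fedge l j) -> a = val l /\ j = stem l.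
  move=> E; have al : a = val l.
    apply/val_inj; apply: (trunk_mutual rG); try exact: tree_vertexP.
    by rewrite E; exact: mutual_sym (fedge_mutual j).
  by split=> //; apply: fedge_inj; rewrite -E rng_stem al.
case: x y => [a|[l i]] [a'|[l' j]].
- by move=> /val_inj /= ->.
- by move=> /mixed /= [-> ->]; rewrite eqxx.
- by move=> /esym /mixed /= [-> ->]; rewrite eqxx.
- move=> /= E; have ll' := fedge_eq_base E; subst l'.
  by rewrite (fedge_inj E).
Qed.

Lemma vertex_map_surj x : exists a, vertex_map a = x.
Proof.
have [l tl lx] := trunk_exists cG nsG x.
have lE : `[< trunk l >] by apply/asboolP.
pose l' : vertex tree := exist _ l lE.
have [<-|nlx] := pselect (l = x); first by exists (inl l').
have gl' : l' \in grafting by rewrite inE; exact: on_cycle_mutual lx nlx.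
pose l'' : grafting := exist _ l' gl'.
have [lb b0 _] := fruitP l''.
have [e ne el] := tl.
have /mapP[f fb xE] := circle_mutual rG ne el lb b0 lx.
have /tnthP[j jE] : f \in in_tuple (fruit l'') by [].
exists (inr (Tagged (fun l => 'I_(size (fruit l))) j)).
by rewrite /= -jE.
Qed.

Lemma edge_map_inj : injective edge_map.
Proof.
have mixed (e : edge tree) (l : grafting) (j : 'I_(size (fruit l))) :
    val e <> fedge l j.
  move=> E; apply: (tree_edgeP e); have [lb _ _] := fruitP l.
  by apply: (closed_walk_cyclic lb); rewrite E mem_tnth.
case=> [e|[l i]] [e'|[l' j]] /=.
- by move=> /val_inj ->.
- by move=> /mixed.
- by move=> /esym /mixed.
- move=> /(congr1 rng) E; have ll' := fedge_eq_base E; subst l'.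
  by rewrite (fedge_inj E).
Qed.

Lemma edge_map_surj f : exists a, edge_map a = f.
Proof.
have [cf|ncf] := pselect (cyclic f); last first.
  have fE : `[< ~ cyclic f >] by apply/asboolP.
  by exists (inl (exist _ f fE)).
have [l tl lx] := trunk_exists cG nsG (rng f).
have lE : `[< trunk l >] by apply/asboolP.
pose l' : vertex tree := exist _ l lE.
have gl' : l' \in grafting by rewrite inE; exact: cyclic_on_cycle cf lx.
pose l'' : grafting := exist _ l' gl'.
have [lb b0 _] := fruitP l''.
have [e ne el] := tl.
have fb : f \in fruit l''.
  apply: (circle_incident rG ne el lb b0 (circle_mutual rG ne el lb b0 lx) cf).
  by right.
have /tnthP[j jE] : f \in in_tuple (fruit l'') by [].
by exists (inr (Tagged (fun l => 'I_(size (fruit l))) j)).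
Qed.

Definition grafted_vertex_map (q : vertex (grafted stem)) : vertex G :=
  vertex_map (repr q).

Lemma grafted_vertex_mapE x :
  grafted_vertex_map (\pi_({eq_quot glued stem})%qT x) = vertex_map x.
Proof.
rewrite /grafted_vertex_map -[LHS]vertex_map_attach -[RHS]vertex_map_attach.
congr vertex_map; apply/eqP.
by have /eqmodP := reprK (\pi_({eq_quot glued stem})%qT x).
Qed.

Lemma grafted_vertex_map_inj : injective grafted_vertex_map.
Proof.
move=> q q' /vertex_map_inj E.
have /eqmodP : glued stem (repr q) (repr q') by rewrite /glued E.
by rewrite !reprK.
Qed.

Lemma grafted_vertex_map_src (a : edge (grafted stem)) :
  grafted_vertex_map (src a) = src (edge_map a).
Proof. by rewrite grafted_vertex_mapE; case: a => [e|[l j]] //=; rewrite src_fedge. Qed.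

Lemma grafted_vertex_map_rng (a : edge (grafted stem)) :
  grafted_vertex_map (rng a) = rng (edge_map a).
Proof. by rewrite grafted_vertex_mapE; case: a => [e|[l j]]. Qed.

Lemma rigid_isomorphic : isomorphic G (grafted stem).
Proof.
have [fv0 fv0K] := choice vertex_map_surj.
have [fe feK] := choice edge_map_surj.
pose fv x : vertex (grafted stem) := \pi_({eq_quot glued stem})%qT (fv0 x).
have fvK x : grafted_vertex_map (fv x) = x by rewrite grafted_vertex_mapE.
exists fv, fe; split.
- by exists grafted_vertex_map => // q; apply: grafted_vertex_map_inj; rewrite fvK.
- by exists edge_map => // a; apply: edge_map_inj; rewrite feK.
- move=> e; apply: grafted_vertex_map_inj.
  by rewrite fvK -[in RHS](feK e); exact: grafted_vertex_map_src.
- move=> e; apply: grafted_vertex_map_inj.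
  by rewrite fvK -[in RHS](feK e); exact: grafted_vertex_map_rng.
Qed.

Lemma rigid_generalized_fruit_tree : generalized_fruit_tree G.
Proof.
exists tree, grafting, (fun l => size (fruit l)), stem; split.
- exact: tree_generalized_tree.
- exact: grafting_leaf.
- exact: grafting_proper.
- exact: rigid_isomorphic.
Qed.

End FruitTreeStructure.

(** * Alternating vertices of a line *)

Section Bridges.
Variable G : digraph.
Implicit Types (x y : vertex G) (e f : edge G) (h : pred (vertex G)).

Lemma bridge_mono e h x y : bridge e h -> reach x y -> h y -> h x.
Proof.
move=> [h1 h2 h3]; elim=> [{}x {}y [f [<- <-]]|//|{}x z {}y _ IH _ IH' /IH'//].
by have [->|/h3 ->] := eqVneq f e.
Qed.

Lemma bridge_crossed e h x y : bridge e h -> reach x y -> h x -> ~~ h y ->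
  reach x (src e) /\ reach (rng e) y.
Proof.
move=> eh; have [h1 h2 h3] := eh.
elim=> [{}x {}y [f [<- <-]]|{}x -> //|{}x z {}y xz IH zy IH' hx hy].
  have [->|/h3 ->] := eqVneq f e; last by move=> ->.
  by split; exact: reach_refl.
have [hz|hz] := boolP (h z).
  by have [zs ry] := IH' hz hy; split=> //; exact: reach_trans xz zs.
by have [xs rz] := IH hx hz; split=> //; exact: reach_trans rz zy.
Qed.

(** A directed path crosses the cut at most once, in the direction of [e]. *)
Lemma bridge_reach e h x y : bridge e h -> reach x y -> h x != h y -> h x /\ ~~ h y.
Proof.
move=> eh xy; have := bridge_mono eh xy.
by case: (h x); case: (h y) => // /(_ isT).
Qed.

Lemma two_bridges_crossed e f h k x y : bridge e h -> bridge f k -> e != f ->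
  reach x y -> h x != h y -> k x != k y ->
  reach (rng e) (src f) \/ reach (rng f) (src e).
Proof.
move=> eh fk ef xy /(bridge_reach eh xy)[hx hy] /(bridge_reach fk xy)[kx ky].
have [xe ey] := bridge_crossed eh xy hx hy.
have [_ _ /(_ e ef) kE] := fk.
have [kr|kr] := boolP (k (rng e)).
  by left; have [] := bridge_crossed fk ey kr ky.
by right; rewrite -kE in kr; have [] := bridge_crossed fk xe kx kr.
Qed.

End Bridges.

Section LineTurns.
Variable G : digraph.
Hypotheses (rG : rigid G) (cG : Defs.connected G) (nsG : ~ strongly_connected G).
Variables (n : nat) (v : nat -> vertex G) (e : nat -> edge G).
Hypothesis v_inj : forall i j, (i <= n)%N -> (j <= n)%N -> v i = v j -> i = j.

Definition forward i : Prop := src (e i) = v i /\ rng (e i) = v i.+1.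
Definition backward i : Prop := rng (e i) = v i /\ src (e i) = v i.+1.

Hypothesis line_edge : forall i, (i < n)%N -> forward i \/ backward i.

Definition turn i : Prop :=
  forward i.-1 /\ backward i \/ backward i.-1 /\ forward i.

Lemma line_incident i : (i < n)%N -> incident (e i) (v i) /\ incident (e i) (v i.+1).
Proof. by move=> /line_edge[[<- <-]|[<- <-]]; split; by [left | right]. Qed.

Lemma line_edge_inj i j : (i < n)%N -> (j < n)%N -> e i = e j -> i = j.
Proof.
move=> ni nj E; have := line_edge ni; have := line_edge nj; rewrite /forward /backward E.
case=> [[-> ->]|[-> ->]] [[E1 E2]|[E1 E2]].
- exact: v_inj (ltnW ni) (ltnW nj) (esym E1).
- have := v_inj ni (ltnW nj) (esym E2).
  have := v_inj nj (ltnW ni) E1; lia.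
- have := v_inj ni (ltnW nj) (esym E2).
  have := v_inj nj (ltnW ni) E1; lia.
- exact: v_inj (ltnW ni) (ltnW nj) (esym E1).
Qed.

Lemma turn_not_cyclic i : (0 < i < n)%N -> turn i ->
  cyclic (e i.-1) -> cyclic (e i) -> False.
Proof.
move=> /andP[i0 ni] ti ci' ci; have ni' : (i.-1 < n)%N by lia.
have : e i.-1 = e i.
  apply: (cyclic_inj rG cG nsG) => //.
  by case: ti => -[[E1 E2] [E3 E4]]; [right; rewrite E2 E3 | left; rewrite E2 E3];
    rewrite prednK.
move/(line_edge_inj ni' ni); lia.
Qed.

(** Once the line has entered a circle along the bridge [e k] it cannot leave,
    as [e k] is the only exit. *)
Lemma cyclic_propagates k m : (k.+1 <= m < n)%N ->
  ~ cyclic (e k) -> cyclic (e k.+1) -> cyclic (e m).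
Proof.
move=> /andP[km mn] nck ck.
have [b [g [[ng kb _] _ bi be]]] := cyclic_circle rG cG nsG ck.
have kn : (k.+1 < n)%N by exact: leq_ltn_trans km mn.
have [ik _] := line_incident kn; have [_ ik'] := line_incident (ltnW kn).
have [_ bk] := bi _ kb.
have eg : e k = g.
  by have [/bi[]|] := be _ _ (bk _ ik) ik'.
suff : e m \in b by move=> /bi[].
elim: m km mn => // m IH; rewrite ltnS leq_eqVlt => /predU1P[<- //|km] mn.
have /bi[_ bm] := IH km (ltnW mn).
have [_ im] := line_incident (ltnW mn); have [im' _] := line_incident mn.
have [//|E] := be _ _ (bm _ im) im'.
have := line_edge_inj mn (ltnW kn) (etrans E (esym eg)); lia.
Qed.

Lemma cyclic_propagates_back k m : (k.+1 < n)%N -> (m <= k)%N ->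
  cyclic (e k) -> ~ cyclic (e k.+1) -> cyclic (e m).
Proof.
move=> kn mk ck nck; apply: contrapT => ncm.
have : exists2 j, (m <= j < k)%N & ~ cyclic (e j) /\ cyclic (e j.+1).
  elim: k mk {kn nck} ck => [|k IH] mk ck.
    by rewrite (eqP (_ : m == 0)%N) in ncm; last by lia.
  have [ck'|nck'] := pselect (cyclic (e k)).
    have mk' : (m <= k)%N.
      by move: mk; rewrite leq_eqVlt => /predU1P[E|//]; rewrite E in ncm.
    by have [j mj jj] := IH mk' ck'; exists j => //; lia.
  exists k => //; rewrite ltnSn andbT.
  by move: mk; rewrite leq_eqVlt => /predU1P[E|//]; rewrite E in ncm.
move=> [j mj [ncj cj]]; apply: nck.
by apply: (cyclic_propagates _ ncj cj); lia.
Qed.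

Section Sides.
Variables (i : nat) (h : pred (vertex G)).
Hypotheses (ni : (i < n)%N) (ih : bridge (e i) h).

Lemma line_side_step j : (j < n)%N -> j != i -> h (v j) = h (v j.+1).
Proof.
move=> nj ji; have [_ _ /(_ (e j))] := ih.
have -> : e j != e i.
  by apply/eqP => /(line_edge_inj nj ni) E; rewrite E eqxx in ji.
by move=> /(_ isT); case: (line_edge nj) => -[-> ->].
Qed.

Lemma line_side_le p : (p <= i)%N -> h (v p) = h (v i).
Proof.
elim: {p}(i - p)%N {-2}p (erefl (i - p)%N) => [|k IH] p E pi.
  by congr (h (v _)); lia.
by rewrite line_side_step ?IH//; lia.
Qed.

Lemma line_side_gt p : (i < p <= n)%N -> h (v p) = h (v i.+1).
Proof.
elim: p => [//|p IH] /andP[ip pn].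
have [->//|ne] := eqVneq p i.
by rewrite -line_side_step// IH//; lia.
Qed.

Lemma line_sides : h (v i) != h (v i.+1).
Proof.
have [h1 h2 _] := ih.
by case: (line_edge ni) h1 h2 => -[-> ->]; case: (h _); case: (h _).
Qed.

Lemma forward_sides : forward i -> h (v i) /\ ~~ h (v i.+1).
Proof. by have [h1 h2 _] := ih => -[<- <-]. Qed.

Lemma backward_sides : backward i -> ~~ h (v i) /\ h (v i.+1).
Proof. by have [h1 h2 _] := ih => -[<- <-]. Qed.

End Sides.

(** If a directed path crossed both [e i] and [e j], it would also pass, in its
    own direction, the bridge [e j.-1], which lies between them or is [e i], and then [e j.-1]
    and [e j] would have the same direction along the line, whereas it turns at the
    vertex [v j]. *)
Lemma turn_separates i j (hi hj hl : pred (vertex G)) : (i < j < n)%N -> turn j ->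
  bridge (e i) hi -> bridge (e j) hj -> bridge (e j.-1) hl ->
  ~ reach (rng (e i)) (src (e j)) /\ ~ reach (rng (e j)) (src (e i)).
Proof.
move=> /andP[ij jn] tj ei ej el.
have ni : (i < n)%N by exact: ltn_trans ij jn.
have nl : (j.-1 < n)%N by lia.
have jE : j.-1.+1 = j by lia.
(* Both ends of [e i] are on the initial side of any later bridge of the line. *)
have before (g : pred (vertex G)) k x : bridge (e k) g -> (k < n)%N -> (i < k)%N ->
    incident (e i) x -> g x = g (v k).
  move=> kg nk ik ix; have [->|->] : x = v i \/ x = v i.+1.
  - by case: (line_edge ni) ix => -[E1 E2] [<-|<-]; rewrite ?E1 ?E2; by [left|right].
  - by rewrite (line_side_le nk kg)//; exact: ltnW.
  - by rewrite (line_side_le nk kg).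
have ir : incident (e i) (rng (e i)) by right.
have is_ : incident (e i) (src (e i)) by left.
split=> R.
  have [[bl fj]|[fl bj]] : (backward j.-1 /\ forward j) \/ (forward j.-1 /\ backward j).
    by case: tj; [right | left].
  - have [lv lv'] := backward_sides el bl; rewrite jE in lv'.
    rewrite (proj1 fj) in R; have := bridge_mono el R lv'.
    have [il|/eqP il] := ltnP i j.-1; first by rewrite (before _ _ _ el nl il ir) (negPf lv).
    have {}il : i = j.-1 by lia.
    by have [_ + _] := el; rewrite -il => /negPf ->.
  - have [jv jv'] := backward_sides ej bj.
    have := bridge_mono ej R; rewrite (before _ _ _ ej jn ij ir) (negPf jv).
    by rewrite (proj2 bj) jv' => /(_ isT).
have [[bl fj]|[fl bj]] : (backward j.-1 /\ forward j) \/ (forward j.-1 /\ backward j).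
  by case: tj; [right | left].
- have [jv jv'] := forward_sides ej fj.
  have := bridge_mono ej R; rewrite (before _ _ _ ej jn ij is_) jv (proj2 fj).
  by rewrite (negPf jv') => /(_ isT).
- have [lv lv'] := forward_sides el fl; rewrite jE in lv'.
  rewrite (proj1 bj) in R; have := bridge_mono el R; rewrite (negPf lv').
  have [il|il] := ltnP i j.-1; first by rewrite (before _ _ _ el nl il is_) lv => /(_ isT).
  have {}il : i = j.-1 by lia.
  by have [+ _ _] := el; rewrite -il => -> /(_ isT).
Qed.

Variable M : nat.
Hypothesis zM : forall x y : vertex G, exists2 m, (m <= M)%N & zigzag m x y.

(** Let D x y count the bridges [e i], with [i] in [S], that separate [x] from [y].
    It is a pseudo-distance, it is at most one between the ends of a directed path
    by [turn_separates], so at most [m] along a zigzag of [m] paths; but every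
    bridge of the line separates its two end points. *)
Lemma noncyclic_turns_bounded (S : {set 'I_n}) :
  (forall i : 'I_n, i \in S ->
     [/\ (0 < i)%N, turn i, ~ cyclic (e i.-1) & ~ cyclic (e i)]) ->
  (#|S| <= M)%N.
Proof.
move=> SP.
have /choice[h hP] (i : 'I_n) : exists h, ~ cyclic (e i) -> bridge (e i) h.
  have [ci|/(rigid_bridge rG)[h ih]] := pselect (cyclic (e i)).
    by exists xpred0.
  by exists h.
have Sh i : i \in S -> bridge (e i) (h i) by move=> /SP[_ _ _ /hP].
pose D x y := #|[set i in S | h i x != h i y]|.
have Dreach x y : reach x y -> (D x y <= 1)%N.
  move=> xy; rewrite leqNgt; apply/negP => /card_gt1P[i [j []]].
  rewrite !inE => /andP[iS ixy] /andP[jS jxy] ij.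
  wlog lij : i j iS jS ixy jxy ij / (i < j)%N.
    move=> W; have [lij|lij|/val_inj E] := ltngtP i j; first exact: W lij.
      by apply: (W j i) lij => //; rewrite eq_sym.
    by rewrite E eqxx in ij.
  have [_ tj nl _] := SP _ jS; have [hl lh] := rigid_bridge rG nl.
  have ijn : (i < j < n)%N by rewrite lij ltn_ord.
  have [R1 R2] := turn_separates ijn tj (Sh _ iS) (Sh _ jS) lh.
  have ee : e i != e j.
    apply/eqP => /(line_edge_inj (ltn_ord i) (ltn_ord j)) E.
    by rewrite E ltnn in lij.
  by case: (two_bridges_crossed (Sh _ iS) (Sh _ jS) ee xy ixy jxy).
have Dsym x y : D x y = D y x.
  by apply: eq_card => i; rewrite !inE eq_sym.
have Dtriangle x y z : (D x z <= D x y + D y z)%N.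
  apply: leq_trans (leq_card_setU _ _); apply: subset_leq_card.
  apply/fintype.subsetP => i; rewrite !inE => /andP[-> /=].
  by case: (h i x); case: (h i y); case: (h i z).
have Dzigzag m x y : zigzag m x y -> (D x y <= m)%N.
  elim: m y => [|m IH] y /=.
    move=> ->; rewrite leqn0 cards_eq0; apply/eqP/setP => i.
    by rewrite !inE eqxx andbF.
  move=> [z /IH xz zy]; apply: leq_trans (Dtriangle _ z _) _.
  rewrite -addn1; apply: leq_add => //.
  by case: zy => /Dreach //; rewrite Dsym.
have [m mM /Dzigzag Dm] := zM (v 0) (v n).
apply: leq_trans mM; apply: leq_trans Dm.
apply: subset_leq_card; apply/fintype.subsetP => i iS; rewrite !inE iS /=.
have ni := ltn_ord i; have ih := Sh _ iS.
rewrite (line_side_le ni ih (leq0n i)) (line_side_gt (p := n) ni ih) ?ni ?leqnn//.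
exact: (line_sides ni ih).
Qed.

(** A turn next to a cyclic edge is where the line enters or leaves a circle;
    each of these happens at most once. *)
Lemma turns_bounded (X : {set 'I_n}) :
  (forall i : 'I_n, i \in X -> (0 < i)%N /\ turn i) -> (#|X| <= M + 2)%N.
Proof.
move=> XP.
pose X1 := [set i in X | `[< cyclic (e i) >]].
pose X2 := [set i in X | `[< cyclic (e i.-1) >] && ~~ `[< cyclic (e i) >]].
pose X0 := [set i in X | ~~ `[< cyclic (e i.-1) >] && ~~ `[< cyclic (e i) >]].
have X1_le : (#|X1| <= 1)%N.
  rewrite leqNgt; apply/negP => /card_gt1P[i [j []]].
  rewrite !inE => /andP[iX /asboolP ci] /andP[jX /asboolP cj] ij.
  wlog lij : i j iX jX ci cj ij / (i < j)%N.
    move=> W; have [lij|lij|/val_inj E] := ltngtP i j; first exact: W lij.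
      by apply: (W j i) lij => //; rewrite eq_sym.
    by rewrite E eqxx in ij.
  have [i0 ti] := XP _ iX; have [j0 tj] := XP _ jX.
  have ni := ltn_ord i; have nj := ltn_ord j.
  have nci : ~ cyclic (e i.-1).
    by move=> ci'; apply: turn_not_cyclic ti ci' ci; rewrite i0.
  have iE : i.-1.+1 = i by lia.
  apply: (turn_not_cyclic _ tj) cj; first by rewrite j0.
  by apply: (cyclic_propagates _ nci); rewrite iE//; lia.
have X2_le : (#|X2| <= 1)%N.
  rewrite leqNgt; apply/negP => /card_gt1P[i [j []]].
  rewrite !inE => /and3P[iX /asboolP ci /asboolP nci] /and3P[jX /asboolP cj /asboolP ncj] ij.
  wlog lij : i j iX jX ci cj nci ncj ij / (i < j)%N.
    move=> W; have [lij|lij|/val_inj E] := ltngtP i j; first exact: W lij.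
      by apply: (W j i) lij => //; rewrite eq_sym.
    by rewrite E eqxx in ij.
  have nj := ltn_ord j; have jE : j.-1.+1 = j by lia.
  apply: nci; apply: (cyclic_propagates_back _ _ cj); rewrite ?jE//; lia.
have X0_le : (#|X0| <= M)%N.
  apply: noncyclic_turns_bounded => i; rewrite !inE => /and3P[iX].
  by move=> /asboolP nci' /asboolP nci; have [i0 ti] := XP _ iX.
apply: (@leq_trans #|X0 :|: (X1 :|: X2)|).
  apply: subset_leq_card; apply/fintype.subsetP => i iX; rewrite !inE iX /=.
  by case: `[< cyclic (e i) >]; case: `[< cyclic (e i.-1) >].
apply: leq_trans (leq_card_setU _ _) _; apply: leq_add => //.
by apply: leq_trans (leq_card_setU _ _) _; apply: (@leq_add _ _ 1 1).
Qed.

End LineTurns.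

Lemma rigid_nb_alternating (G : digraph) (M : nat) :
  rigid G -> Defs.connected G -> ~ strongly_connected G ->
  (forall x y : vertex G, exists2 m, (m <= M)%N & zigzag m x y) ->
  forall n (v : 'I_n.+1 -> vertex G) (e : 'I_n -> edge G),
    (0 < n)%N -> line v e -> (nb_alternating v e <= M + 2)%N.
Proof.
move=> rG cG nsG zM [//|n] v e _ [vinj vE].
pose v' k := v (inord k); pose e' k := e (inord k).
have v'_inj i j : (i <= n.+1)%N -> (j <= n.+1)%N -> v' i = v' j -> i = j.
  by move=> ni nj /vinj /(congr1 (@nat_of_ord _)); rewrite !inordK.
have line_edge i : (i < n.+1)%N -> forward v' e' i \/ backward v' e' i.
  move=> ni; have := vE (inord i).
  have -> : widen_ord (leqnSn n.+1) (inord i) = inord i.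
    by apply: ord_inj; rewrite /= !inordK//; exact: ltnW.
  have -> : lift ord0 (inord i : 'I_n.+1) = inord i.+1.
    by apply: ord_inj; rewrite /= !inordK.
  by move=> E; case: (pair_set_eq E) => -[E1 E2]; [right | left]; split.
have at_vertex (i : 'I_n.+2) (j : 'I_n.+1) : incident (e j) (v i) ->
    i = j :> nat \/ i = j.+1 :> nat.
  have eE : e j = e' j by rewrite /e' inord_val.
  have iE : v i = v' i by rewrite /v' inord_val.
  rewrite eE iE => ij; have nj := ltn_ord j; have ni := ltn_ord i.
  by case: (line_edge j nj) ij => -[E1 E2] [] E; [left|right|right|left];
    apply: v'_inj; rewrite // -?E ?E1 ?E2//; exact: ltnW.
have alt_turn (i : 'I_n.+2) : alternating v e i ->
    [/\ (0 < i)%N, (i < n.+1)%N & turn v' e' i].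
  have consecutive (j1 j2 : 'I_n.+1) : j1 != j2 ->
      incident (e j1) (v i) -> incident (e j2) (v i) ->
      (i = j1.+1 :> nat /\ i = j2 :> nat) \/ (i = j2.+1 :> nat /\ i = j1 :> nat).
    move=> j12 /at_vertex h1 /at_vertex h2.
    have : (j1 : nat) != j2 by [].
    by lia.
  move=> alt.
  have [j1 [j2 [E1 E2 same]]] : exists j1 j2 : 'I_n.+1,
      [/\ i = j1.+1 :> nat, i = j2 :> nat &
       (src (e j1) = v i /\ src (e j2) = v i) \/ (rng (e j1) = v i /\ rng (e j2) = v i)].
    case/orP: alt => /eqP c2.
      have /card_gt1P[a [b [/eqP sa /eqP sb ab]]] :
        (1 < #|[pred j | src (e j) == v i]|)%N by rewrite c2.
      have [[? ?]|[? ?]] := consecutive a b ab (or_introl sa) (or_introl sb).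
        by exists a, b; split=> //; left.
      by exists b, a; split=> //; left.
    have /card_gt1P[a [b [/eqP sa /eqP sb ab]]] :
      (1 < #|[pred j | rng (e j) == v i]|)%N by rewrite c2.
    have [[? ?]|[? ?]] := consecutive a b ab (or_intror sa) (or_intror sb).
      by exists a, b; split=> //; right.
    by exists b, a; split=> //; right.
  have n1 := ltn_ord j1; have n2 := ltn_ord j2.
  split; [by rewrite E1 | by rewrite E2 | ].
  have e1 : e j1 = e' i.-1 by rewrite E1 /e' /= inord_val.
  have e2 : e j2 = e' i by rewrite E2 /e' inord_val.
  have iE : v i = v' i by rewrite /v' inord_val.
  rewrite e1 e2 iE in same; rewrite /turn.
  have iK : i.-1.+1 = i by lia.
  have l1 := line_edge i.-1 (_ : (i.-1 < n.+1)%N); have {}l1 := l1 ltac:(lia).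
  have l2 := line_edge i (_ : (i < n.+1)%N); have {}l2 := l2 ltac:(lia).
  have ne1 : v' i.-1 <> v' i by move/v'_inj => h; have := h ltac:(lia) ltac:(lia); lia.
  have ne2 : v' i.+1 <> v' i by move/v'_inj => h; have := h ltac:(lia) ltac:(lia); lia.
  case: same => -[s1 s2].
    right; split.
      by case: l1 => // -[E _]; case: ne1; rewrite -E.
    by case: l2 => // -[_ E]; case: ne2; rewrite -E.
  left; split.
    by case: l1 => // -[E _]; case: ne1; rewrite -E.
  by case: l2 => // -[_ E]; case: ne2; rewrite -E.
pose X := [set j : 'I_n.+1 | alternating v e (widen_ord (leqnSn n.+1) j)]%SET.
apply: (@leq_trans #|X|); last first.
  apply: (turns_bounded rG cG nsG v'_inj line_edge zM) => j.
  by rewrite inE => /alt_turn[].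
have widen_inj : injective (widen_ord (leqnSn n.+1)).
  by move=> a b /(congr1 (@nat_of_ord _)) ab; exact: ord_inj.
rewrite /nb_alternating -(card_imset X widen_inj).
apply: subset_leq_card; apply/fintype.subsetP => i; rewrite inE => ai.
have [_ ni _] := alt_turn _ ai.
have iE : i = widen_ord (leqnSn n.+1) (Ordinal ni) by apply: ord_inj.
by rewrite iE; apply: imset_f; rewrite inE -iE.
Qed.

Theorem corollary6p19 (R : realType) (G : digraph)
  (hder : forall d, bounded_derivation (@graph_norm_algebra R G) d ->
     exists2 T, @graph_wot_algebra R G T &
       forall A, @graph_norm_algebra R G A -> d A = inner_derivation T A) :
  (forall C, components G C -> ~ strongly_connected (induced C) ->
     generalized_fruit_tree (induced C)) /\
  (ereal_sup [set alternating_number (induced C) R | C in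
     [set C | components G C /\ ~ strongly_connected (induced C)]] < +oo)%E.
Proof.
have rG := inner_rigid hder; split=> [C compC nsC|].
  exact (rigid_generalized_fruit_tree (component_rigid compC rG)
    (induced_component_connected compC) nsC).
have [M zM] := inner_zigzag_bounded hder.
apply: le_lt_trans (ltry ((M + 2)%:R : R)).
apply: ge_ereal_sup => _ [C [compC nsC] <-].
apply: ge_ereal_sup => _ [n [v [e [n0 ve ->]]]].
rewrite lee_fin ler_nat.
apply: (rigid_nb_alternating (component_rigid compC rG)
  (induced_component_connected compC) nsC) => //.
move=> x y; have [m mM xy] := zM _ _ (component_mutual compC (valP x) (valP y)).
by exists m => //; exact: component_zigzag.
Qed.
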